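(* Let $k,n\ge 2$ be integers, let $A_0,A_1,\dots,A_k$ be $n\times n$ generic matrices over $\mathbb{Q}$, let $K$ be the field generated over $\mathbb{Q}$ by all the entries of $A_0,\dots,A_k$, and let $\overline{K}$ be its algebraic closure. Consider the equation $$A_kX^k+\cdots+A_1X+A_0=0_n\qquad\text{in the unknown } X\in\mathcal{M}_n(\overline{K}).\qquad ( * )$$ (i) Equation $( * )$ has exactly $\binom{kn}{n}$ solutions; they are simple and belong to $\mathcal{M}_n(K((\lambda_i)_i))$, where $(\lambda_i)_{i\le kn}$ are the roots of a polynomial of degree $kn$ that has $S_{kn}$ as Galois group over $K$. Moreover $K((\lambda_i)_i)$ is the minimal extension $L$ of $K$ such that $\mathcal{M}_n(L)$ contains all solutions of $( * )$. (ii) Equation $( * )$ is solvable if and only if $n=k=2$.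
   Context: Generic matrices: $n\times n$ matrices $A_r=[a_{r;i,j}]$ are called generic (over $\mathbb{Q}$) if all their entries $a_{r;i,j}$ (over all $r,i,j$) are independent commuting indeterminates over $\mathbb{Q}$, i.e. are algebraically independent over $\mathbb{Q}$. A matrix equation $f(X)=0_n$ over $\overline{K}$ is regarded as the system of $n^2$ polynomial equations $f_{i,j}(X)=0$ in the $n^2$ entries $x_{i,j}$ of $X$. An isolated solution $X_0$ has multiplicity $\dim_{\overline{K}}\mathcal{O}_{X_0}/((f_{i,j})_{i,j})_{X_0}$, where $\mathcal{O}_{X_0}$ is the local ring of the affine space $\mathcal{M}_n(\overline{K})$ at $X_0$ and $((f_{i,j})_{i,j})_{X_0}$ is the ideal generated by the $f_{i,j}$ in it; $X_0$ is simple if it is isolated of multiplicity $1$. Solvable: when the equation has a finite positive number of solutions, it is called solvable if the entries of each solution can be calculated by radicals over $K$ (i.e. lie in a radical extension of $K$), and non-solvable otherwise. *)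

(* Defs.v *)
From HB Require Import structures.
From mathcomp Require Import all_boot all_order all_fingroup all_algebra all_solvable all_field.
From mathcomp.multinomials Require Import mpoly.

Set Implicit Arguments.
Unset Strict Implicit.
Unset Printing Implicit Defensive.

Import GRing.Theory.
Local Open Scope ring_scope.

(* Subfields of a possibly infinite extension are Prop-valued predicates: the
   {subfield L} of MathComp only covers finite-dimensional L.  Since 0^-1 = 0,
   closure under division needs no side condition. *)
Definition is_subfield (L : fieldType) (E : L -> Prop) : Prop :=
  [/\ E 1, forall x y, E x -> E y -> E (x - y)
         & forall x y, E x -> E y -> E (x / y)].

(* F(S) *)
Definition adjoin (L : fieldType) (F S : L -> Prop) : L -> Prop :=
  fun x => forall E : L -> Prop, is_subfield E ->
    (forall y, F y -> E y) -> (forall y, S y -> E y) -> E x.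

Definition img (T U : Type) (f : T -> U) : U -> Prop :=
  fun y => exists x, y = f x.

Inductive radical_extension (L : fieldType) (F : L -> Prop) :
    (L -> Prop) -> Prop :=
| radical_base : radical_extension F F
| radical_step (E : L -> Prop) (a : L) (m : nat) :
    radical_extension F E -> (0 < m)%N -> E (a ^+ m) ->
    radical_extension F (adjoin E (fun y => y = a)).

Definition alg_independent (F K : fieldType) (phi : {rmorphism F -> K})
    (I : finType) (a : I -> K) : Prop :=
  forall p : {mpoly F[#|I|]},
    mmap phi (fun i => a (enum_val i)) p = 0 -> p = 0.

Definition entries (K : Type) (k n : nat) (A : 'I_k.+1 -> 'M[K]_n) :
    'I_k.+1 * 'I_n * 'I_n -> K :=
  fun t => A t.1.1 t.1.2 t.2.

Definition generic_matrices (K : fieldType) (phi : {rmorphism rat -> K})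
    (k n : nat) (A : 'I_k.+1 -> 'M[K]_n) : Prop :=
  alg_independent phi (entries A).

Definition generated_by_entries (K : fieldType) (phi : {rmorphism rat -> K})
    (k n : nat) (A : 'I_k.+1 -> 'M[K]_n) : Prop :=
  forall x : K, adjoin (img phi) (img (entries A)) x.

Definition is_algebraic_closure (K : fieldType) (Kbar : closedFieldType)
    (iota : {rmorphism K -> Kbar}) : Prop :=
  forall x : Kbar, algebraicOver iota x.

Section PolynomialSystems.

Variables (F : fieldType) (N : nat) (I : finType) (f : I -> {mpoly F[N]}).

Definition zero_of (v : 'rV[F]_N) : Prop := forall i, (f i).@[v 0] = 0.

(* Isolated for the Zariski topology: {v} is cut out of the zero set by a
   basic open set g <> 0. *)
Definition isolated_zero (v : 'rV[F]_N) : Prop :=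
  zero_of v /\
  exists g : {mpoly F[N]}, g.@[v 0] != 0 /\
    forall w : 'rV[F]_N, zero_of w -> g.@[w 0] != 0 -> w = v.

(* The local ring of affine N-space at v, inside the field of rational
   functions. *)
Definition local_ring (v : 'rV[F]_N) (r : {fraction {mpoly F[N]}}) : Prop :=
  exists p q : {mpoly F[N]},
    q.@[v 0] != 0 /\ r = tofrac p / tofrac q.

Definition local_ideal (v : 'rV[F]_N) (r : {fraction {mpoly F[N]}}) : Prop :=
  exists g : I -> {fraction {mpoly F[N]}},
    (forall i, local_ring v (g i)) /\ r = \sum_i g i * tofrac (f i).

(* The quotient of the local ring by the local ideal has F-dimension d: it has
   a basis of size d. *)
Definition local_quotient_dim (v : 'rV[F]_N) (d : nat) : Prop :=
  exists b : 'I_d -> {fraction {mpoly F[N]}},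
    [/\ forall i, local_ring v (b i),
        forall r, local_ring v r ->
          exists c : 'I_d -> F,
            local_ideal v (r - \sum_i tofrac (c i)%:MP * b i)
      & forall c : 'I_d -> F,
          local_ideal v (\sum_i tofrac (c i)%:MP * b i) ->
          forall i, c i = 0].

Definition has_multiplicity (v : 'rV[F]_N) (d : nat) : Prop :=
  isolated_zero v /\ local_quotient_dim v d.

Definition simple_zero (v : 'rV[F]_N) : Prop := has_multiplicity v 1.

End PolynomialSystems.

Definition mx_poly_eval (R : comNzRingType) (k n : nat)
    (A : 'I_k.+1 -> 'M[R]_n) (X : 'M[R]_n) : 'M[R]_n :=
  \sum_(r < k.+1) A r *m X ^+ r.

Definition mx_solution (R : comNzRingType) (k n : nat)
    (A : 'I_k.+1 -> 'M[R]_n) (X : 'M[R]_n) : Prop :=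
  mx_poly_eval A X = 0.

(* The n ^ 2 polynomials f_(i,j) in the entries x_(i,j) of X, the latter being
   numbered as in mxvec. *)
Definition mx_system (F : fieldType) (k n : nat) (A : 'I_k.+1 -> 'M[F]_n) :
    'I_n * 'I_n -> {mpoly F[n * n]} :=
  fun t => mx_poly_eval (fun r => map_mx (@mpolyC (n * n) F) (A r))
             (\matrix_(i, j) 'X_(mxvec_index i j)) t.1 t.2.

Definition simple_solution (F : fieldType) (k n : nat)
    (A : 'I_k.+1 -> 'M[F]_n) (X : 'M[F]_n) : Prop :=
  simple_zero (mx_system A) (mxvec X).

Definition mx_over (L : Type) (n : nat) (E : L -> Prop) (X : 'M[L]_n) : Prop :=
  forall i j, E (X i j).

Definition finite_solutions (F : fieldType) (k n : nat)
    (A : 'I_k.+1 -> 'M[F]_n) (s : seq 'M[F]_n) : Prop :=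
  uniq s /\ forall X, mx_solution A X <-> X \in s.

Definition solvable_equation (L : fieldType) (F : L -> Prop) (k n : nat)
    (A : 'I_k.+1 -> 'M[L]_n) : Prop :=
  (exists2 s, finite_solutions A s & s != [::]) /\
  forall X, mx_solution A X ->
    exists2 R, radical_extension F R & mx_over R X.

(* The Galois group over K of a splitting field of p is isomorphic to S_d. *)
Definition has_galois_group_Sym (K : fieldType) (p : {poly K}) (d : nat) :
    Prop :=
  exists2 L : splittingFieldType K,
    splittingFieldFor 1%VS (map_poly (in_alg L) p) {:L}%VS
  & 'Gal({:L} / 1) \isog [set: 'S_d].

(* Main.v *)
Require Import Defs.
From HB Require Import structures.
From Stdlib Require Import Classical ClassicalEpsilon FunctionalExtensionality.
From mathcomp Require Import all_boot all_order all_fingroup all_algebra all_solvable all_field.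
From mathcomp Require Import ring zify.
From mathcomp.multinomials Require Import mpoly.

(* The solutions of the matrix equation are studied through the pencil
   P(y) = sum_r A_r y^r and p = det P, of degree kn.  If p has distinct roots
   x_i, with kernel vectors v_i of P(x_i), then the characteristic polynomial
   of a solution X divides p, every eigenvector of X is some v_i, and the
   solutions correspond to the sets of n roots, provided that any n of the v_i
   are independent.

   For the generic A everything follows from inverting this construction: in
   the field M of rational functions in indeterminates x_i, v_i (i < kn) and C,
   there is a unique matrix polynomial with leading coefficient C and
   eigenpairs (x_i, v_i); up to the factor det(W)^2, W being the block
   Vandermonde matrix of the pairs, its coefficients are polynomials that are
   invariant under permutations of the pairs.  Specializing x_i, v_i and C to
   the eigenpairs and leading coefficient of A shows that these coefficients
   are algebraically independent, so that K embeds in M, and S_(kn) permutes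
   the roots x_i of p over K.

   A radical tower is fixed pointwise by some derived subgroup of the Galois
   group of a large enough normal extension, whose image in S_(kn) would be
   trivial: hence kn <= 4. *)

Set Implicit Arguments.
Unset Strict Implicit.
Unset Printing Implicit Defensive.

Import GRing.Theory.
Local Open Scope ring_scope.

(** * Field extensions *)

(** Two difficulties shape the argument. The kn eigenpairs of [A] are available only once det P is
    known to be separable, and this is visible at first only for the interpolated pencil over M,
    whose roots are indeterminates. The resultant of det P and its derivative is a polynomial in the
    coefficients; being nonzero at the interpolated pencil, it is a nonzero polynomial, hence
    nonzero at the generic [A]. This transfer precedes the embedding of K in M, so there is no
    circle. The field M is transcendental over K and cannot be mapped over K to the algebraic
    closure. Only the field generated over K by the roots x_i, finite over K, is extracted from M;
    the independence of any n kernel vectors and the symmetry of the relations between the roots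
    pass to it, and then to the closure through any K-embedding. For minimality, traces of solutions
    are sums of n distinct roots, and these sums generate all the roots. Simplicity rests on
    separability: P(y) = Q(y)(y - X), and det Q cannot vanish at an eigenvalue of X. *)

Lemma ex_min_size_poly (K : fieldType) (P : {poly K} -> Prop) :
  (exists p, P p) -> exists2 p, P p & forall q, P q -> (size p <= size q)%N.
Proof.
case=> p; elim/ltn_ind: {p}(size p) {-2}p (erefl (size p)) => m IH p sz_p Pp.
have [[q Pq ltqp]|noq] := classic (exists2 q, P q & (size q < m)%N).
  exact: IH ltqp q (erefl _) Pq.
exists p => // q Pq; rewrite leqNgt; apply/negP=> ltqp; apply: noq.
by exists q => //; rewrite -sz_p.
Qed.

(** The generator is kept as an explicit combination of the list with natural coefficients: a
    permutation of the list then acts on it, and it visibly lies in the field that the list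
    generates. *)
Lemma PET_seq (K M : fieldType) (j : {rmorphism K -> M}) (s : seq M) :
    [pchar K] =i pred0 -> (forall x, x \in s -> algebraicOver j x) ->
  exists z, [/\ algebraicOver j z,
     exists a : nat -> nat, z = \sum_(i < size s) s`_i *+ a i
   & exists ps, s = [seq (map_poly j p).[z] | p <- ps]].
Proof.
move=> ch0; elim: s => [|x s IH] algs.
  exists 0; split; [exact: algebraic0 | by exists id; rewrite big_ord0 | by exists nil].
have [|z [algz [a Dz] [ps Ds]]] := IH.
  by move=> y sy; apply: algs; rewrite inE sy orbT.
have [rx nz_rx rx0] := algs x (mem_head _ _).
(* The theorem for two elements yields a difference as generator; applying it to [- z] turns this
   into the sum [x *+ n + z]. *)
have [rz nz_rz rz0] : algebraicOver j (- z) by apply: algebraic_opp.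
have [n [[pz Dpz] [px Dpx]]] := pchar0_PET nz_rz rz0 nz_rx rx0 ch0.
rewrite opprK in Dpz Dpx.
exists (x *+ n + z); split.
- by apply: algebraic_add => //; rewrite -mulr_natr; apply: algebraic_mul;
    [exists rx | rewrite -(rmorph_nat j); apply: algebraic_id].
- exists (fun i => if i is i'.+1 then a i' else n).
  by rewrite /= big_ord_recl Dz.
- exists (px :: [seq p \Po (- pz) | p <- ps]); rewrite /= Dpx; congr (_ :: _).
rewrite -map_comp Ds; apply: eq_map => p /=.
by rewrite map_comp_poly horner_comp rmorphN hornerN Dpz opprK.
Qed.

(** Adjoining a root of the polynomial of least degree that kills a primitive element turns the
    subfield K(s) of a possibly infinite [M] into a finite extension, open to Galois theory. *)
Lemma fieldExt_generated (K M : fieldType) (j : {rmorphism K -> M}) (s : seq M) :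
    [pchar K] =i pred0 -> (forall x, x \in s -> algebraicOver j x) ->
  exists (L : fieldExtType K) (e : {rmorphism L -> M}) (s1 : seq L),
    [/\ forall c, e c%:A = j c, map e s1 = s & <<1 & s1>>%VS = fullv].
Proof.
move=> ch0 algs.
have [z [[q0 nzq0 q0z] [a Dz] [ps Ds]]] := PET_seq ch0 algs.
have [] := @ex_min_size_poly K (fun p => p != 0 /\ root (map_poly j p) z).
  by exists q0.
move=> r [nz_r rz0] min_r.
have irr_r : irreducible_poly r.
  by apply/(subfx_irreducibleP rz0 nz_r) => q qz0 nzq; apply: min_r.
pose L : fieldExtType K := SubFieldExtType rz0 irr_r.
pose e : {rmorphism L -> M} := @subfx_inj _ _ j z r.
pose z1 : L := subfx_root j z r.
have ez1 : e z1 = z by exact: subfx_inj_root.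
have z1gen xx : exists p, fieldExt_horner z1 p = xx.
  by have [p ->] := subfxEroot rz0 nz_r xx; exists p.
have eC c : e c%:A = j c by exact: (subfx_inj_base rz0).
pose inL := fieldExt_horner z1.
have inLK p : e (inL p) = (map_poly j p).[z].
  rewrite /= -horner_map ez1 -map_poly_comp; congr _.[z].
  by apply: eq_map_poly => b /=; apply: eC.
exists L, e, (map inL ps); split=> //.
  by rewrite -map_comp Ds (eq_map inLK).
have sz_ps : size ps = size s by rewrite Ds size_map.
apply/vspaceP=> x; rewrite memvf; have [p {x}<-] := z1gen x.
elim/poly_ind: p => [|p b ApQs]; first by rewrite rmorph0 mem0v.
rewrite rmorphD rmorphM /= fieldExt_hornerX fieldExt_hornerC -/inL.
suffices Dz1 : z1 = \sum_(i < size s) (map inL ps)`_i *+ a i.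
  apply: rpredD; last by rewrite memvZ ?mem1v.
  rewrite memvM // Dz1 memv_suml // => i _.
  by rewrite rpredMn ?seqv_sub_adjoin ?mem_nth // size_map sz_ps.
apply: (fmorph_inj e); rewrite ez1 Dz rmorph_sum; apply: eq_bigr => i _.
by rewrite rmorphMn {1}Ds !(nth_map 0) ?sz_ps //= inLK.
Qed.

(** Compatibility with subtraction and [T 0 y -> y = 0] make [T] single-valued. Maps out of a field
    can thus be given on representatives, such as fractions or polynomials in a generator. *)
Lemma rmorphism_of_graph (E F : comNzRingType) (T : E -> F -> Prop) :
    (forall x, exists y, T x y) -> T 1 1 ->
    (forall x y x' y', T x y -> T x' y' -> T (x - x') (y - y')) ->
    (forall x y x' y', T x y -> T x' y' -> T (x * x') (y * y')) ->
    (forall y, T 0 y -> y = 0) ->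
  exists f : {rmorphism E -> F}, forall x y, T x y -> f x = y.
Proof.
move=> totT T1 TB TM T0.
pose f x := proj1_sig (constructive_indefinite_description _ (totT x)).
have Tf x : T x (f x) by rewrite /f; case: constructive_indefinite_description.
have fP x y : T x y -> f x = y.
  by move=> Txy; apply/subr0_eq/T0; rewrite -(subrr x); apply: TB.
have fB : zmod_morphism f by move=> x y; apply/fP/TB.
have fM : monoid_morphism f.
  by split=> [|x y]; apply: fP => //; apply: TM.
pose fA := GRing.isZmodMorphism.Build E F f fB.
pose fR := GRing.isMonoidMorphism.Build E F f fM.
pose g : {rmorphism E -> F} := HB.pack f fA fR.
by exists g.
Qed.

Lemma rmorphism_of_fractions (R : comNzRingType) (E F : fieldType)
    (u : {rmorphism R -> E}) (w : {rmorphism R -> F}) :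
    injective u -> injective w -> (forall x, exists a b, x = u a / u b) ->
  exists g : {rmorphism E -> F}, forall a, g (u a) = w a.
Proof.
move=> inju injw fracE.
have nzu a : (u a == 0) = (a == 0) by rewrite -(inj_eq inju) rmorph0.
have nzw a : (w a == 0) = (a == 0) by rewrite -(inj_eq injw) rmorph0.
pose T x y := exists a b, [/\ b != 0, x = u a / u b & y = w a / w b].
have [||_ _ _ _ [a [b [nzb -> ->]]] [c [d [nzd -> ->]]]|
      _ _ _ _ [a [b [nzb -> ->]]] [c [d [nzd -> ->]]]||g gP] :=
  @rmorphism_of_graph E F T.
- move=> x; have [a [b ->]] := fracE x.
  have [->|nzb] := eqVneq b 0.
    by exists 0, 0, 1; rewrite oner_neq0 !rmorph0 invr0 mulr0 !mul0r.
  by exists (w a / w b), a, b.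
- by exists 1, 1; rewrite oner_neq0 !rmorph1 !divr1.
- have [nzub nzud] : u b != 0 /\ u d != 0 by rewrite !nzu.
  have [nzwb nzwd] : w b != 0 /\ w d != 0 by rewrite !nzw.
  exists (a * d - c * b), (b * d); split.
  + by rewrite -nzu rmorphM mulf_neq0.
  + by rewrite -mulNr addf_div // rmorphB !rmorphM mulNr.
  + by rewrite -mulNr addf_div // rmorphB !rmorphM mulNr.
- exists (a * c), (b * d); rewrite !mulf_div !rmorphM; split=> //.
  by rewrite -nzu rmorphM mulf_neq0 ?nzu.
- move=> y [a [b [nzb /esym/eqP + ->]]].
  rewrite mulf_eq0 invr_eq0 !nzu (negPf nzb) orbF => /eqP->.
  by rewrite rmorph0 mul0r.
by exists g => a; apply: gP; exists a, 1; rewrite oner_neq0 !rmorph1 !divr1.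
Qed.

Lemma fieldExt_embed (K : fieldType) (L : fieldExtType K)
    (Kbar : closedFieldType) (iota : {rmorphism K -> Kbar}) :
  [pchar K] =i pred0 -> exists e : {rmorphism L -> Kbar}, forall c, e c%:A = iota c.
Proof.
move=> ch0; pose z := separable_generator 1%AS {:L}%AS.
have chL0 : [pchar L] =i pred0.
  by move=> p; rewrite -(ch0 p) (fmorph_pchar (in_alg L)).
have genz x : x \in <<1; z>>%VS.
  rewrite -eq_adjoin_separable_generator ?memvf ?subvf //.
  by apply/separableP=> y _; apply: pcharf0_separable.
have [f Df] : exists f, minPoly 1%AS z = map_poly (in_alg L) f.
  have /polyOver1P[f Df] := minPolyOver 1%AS z; by exists f.
have szf : (1 < size (map_poly iota f))%N.
  rewrite size_map_poly -(size_map_poly (in_alg L)) -Df size_minPoly.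
  by rewrite ltnS.
have [y y0] : exists y, root (map_poly iota f) y.
  by apply: closed_rootP; rewrite neq_ltn szf orbT.
(* The generator [z] is sent to a root [y] of its minimal polynomial. If [p] vanishes at [z], this
   minimal polynomial divides it, so [p] vanishes at [y]. *)
pose T x t := exists p, x = (map_poly (in_alg L) p).[z] /\ t = (map_poly iota p).[y].
have [||_ _ _ _ [p [-> ->]] [q [-> ->]]|_ _ _ _ [p [-> ->]] [q [-> ->]]||e eP] :=
  @rmorphism_of_graph L Kbar T.
- move=> x; have /Fadjoin1_polyP[p ->] := genz x.
  by exists (map_poly iota p).[y], p.
- by exists 1; rewrite !rmorph1 !hornerC.
- by exists (p - q); rewrite !rmorphB !hornerE.
- by exists (p * q); rewrite !rmorphM !hornerE.
- move=> t [p [/esym/eqP p0 ->]].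
  have: minPoly 1%AS z %| map_poly (in_alg L) p.
    by apply: minPoly_dvdp; rewrite ?alg_polyOver.
  rewrite Df dvdp_map -(dvdp_map iota) => /dvdpP[q ->].
  by rewrite hornerM (rootP y0) mulr0.
by exists e => c; apply: eP; exists c%:P; rewrite !map_polyC !hornerC.
Qed.

(** * Galois groups and symmetric relations *)

Section Subfields.
Variables (M : fieldType) (E : M -> Prop) (sfE : is_subfield E).

Lemma subfield1 : E 1. Proof. by case: sfE. Qed.
Lemma subfieldB x y : E x -> E y -> E (x - y). Proof. by case: sfE => _ EB _; apply: EB. Qed.
Lemma subfield_div x y : E x -> E y -> E (x / y). Proof. by case: sfE => _ _; apply. Qed.
Lemma subfield0 : E 0.
Proof. by rewrite -(subrr 1); apply: subfieldB; apply: subfield1. Qed.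
Lemma subfieldN x : E x -> E (- x).
Proof. by move=> Ex; rewrite -sub0r; apply: subfieldB => //; apply: subfield0. Qed.
Lemma subfieldD x y : E x -> E y -> E (x + y).
Proof. by move=> Ex Ey; rewrite -[y]opprK; apply: subfieldB => //; apply: subfieldN. Qed.
Lemma subfieldV x : E x -> E x^-1.
Proof. by move=> Ex; rewrite -div1r; apply: subfield_div => //; apply: subfield1. Qed.
Lemma subfieldM x y : E x -> E y -> E (x * y).
Proof. by move=> Ex Ey; rewrite -[y]invrK; apply: subfield_div => //; apply: subfieldV. Qed.
Lemma subfield_nat m : E m%:R.
Proof.
elim: m => [|m IH]; first exact: subfield0.
by rewrite mulrS; apply: subfieldD => //; apply: subfield1.
Qed.
Lemma subfieldX x m : E x -> E (x ^+ m).
Proof.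
move=> Ex; elim: m => [|m IH]; first exact: subfield1.
by rewrite exprS; apply: subfieldM.
Qed.
Lemma subfield_sum (I : finType) (f : I -> M) : (forall i, E (f i)) -> E (\sum_i f i).
Proof.
by move=> Ef; elim/big_rec: _ => [|i x _ Ex]; [apply: subfield0 | apply: subfieldD].
Qed.
End Subfields.

Lemma adjoin_subfield (M : fieldType) (F S : M -> Prop) : is_subfield (adjoin F S).
Proof.
split=> [E [E1 _ _] // |x y Ex Ey E sfE sFE sSE|x y Ex Ey E sfE sFE sSE].
  by apply: subfieldB => //; [apply: Ex | apply: Ey].
by apply: subfield_div => //; [apply: Ex | apply: Ey].
Qed.

Lemma adjoin_base (M : fieldType) (F S : M -> Prop) x : F x -> adjoin F S x.
Proof. by move=> Fx E _ sFE _; apply: sFE. Qed.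

Lemma adjoin_gen (M : fieldType) (F S : M -> Prop) x : S x -> adjoin F S x.
Proof. by move=> Sx E _ _; apply. Qed.

Lemma adjoin_sub (M : fieldType) (F S E : M -> Prop) : is_subfield E ->
  (forall x, F x -> E x) -> (forall x, S x -> E x) -> forall x, adjoin F S x -> E x.
Proof. by move=> sfE sFE sSE x; apply. Qed.

Lemma img_subfield (K M : fieldType) (j : {rmorphism K -> M}) : is_subfield (img j).
Proof.
split=> [|_ _ [x ->] [y ->]|_ _ [x ->] [y ->]].
- by exists 1; rewrite rmorph1.
- by exists (x - y); rewrite rmorphB.
- by exists (x / y); rewrite fmorph_div.
Qed.

(** Links finite-dimensional adjunction with Prop-valued subfields, by induction on the list:
    elements are polynomials in the last generator. *)
Lemma seq_adjoin_sub (K M : fieldType) (L : fieldExtType K) (e : {rmorphism L -> M})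
    (E : M -> Prop) (s : seq L) : is_subfield E -> (forall c, E (e c%:A)) ->
  (forall y, y \in s -> E (e y)) -> forall x, x \in <<1 & s>>%VS -> E (e x).
Proof.
move=> sfE EK; elim/last_ind: s => [_|s z IH Es] x.
  by rewrite Fadjoin_nil => /vlineP[c ->].
rewrite adjoin_rcons => /Fadjoin_polyP[p /polyOverP Kp ->].
have {}IH y : y \in <<1 & s>>%VS -> E (e y).
  by apply: IH => t st; apply: Es; rewrite mem_rcons inE st orbT.
rewrite horner_coef rmorph_sum; apply: subfield_sum => // i.
rewrite rmorphM rmorphXn; apply: subfieldM => //; first exact: IH.
by apply: subfieldX => //; apply: Es; rewrite mem_rcons mem_head.
Qed.

(** Stands for an action of the full symmetric group on the [z i] over K, without a normal or even
    finite extension to act on; it therefore passes through embeddings in both directions. *)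
Definition symmetric_relations (K M : fieldType) (j : {rmorphism K -> M}) d
    (z : 'I_d -> M) :=
  forall (t : 'S_d) (h : {mpoly K[d]}),
    mmap j z h = 0 -> mmap j (fun i => z (t i)) h = 0.

Lemma mmap_rmorph (K M M' : fieldType) (j : {rmorphism K -> M})
    (e : {rmorphism M -> M'}) (j' : {rmorphism K -> M'}) d (z : 'I_d -> M)
    (z' : 'I_d -> M') (h : {mpoly K[d]}) :
  (forall c, e (j c) = j' c) -> (forall i, e (z i) = z' i) ->
  e (mmap j z h) = mmap j' z' h.
Proof.
move=> ej ez; rewrite /mmap rmorph_sum; apply: eq_bigr => m _.
rewrite rmorphM ej; congr (_ * _); rewrite /mmap1 rmorph_prod.
by apply: eq_bigr => i _; rewrite rmorphXn ez.
Qed.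

Lemma symmetric_relations_rmorph (K M M' : fieldType) (j : {rmorphism K -> M})
    (e : {rmorphism M -> M'}) (j' : {rmorphism K -> M'}) d (z : 'I_d -> M)
    (z' : 'I_d -> M') :
  (forall c, e (j c) = j' c) -> (forall i, e (z i) = z' i) ->
  symmetric_relations j z <-> symmetric_relations j' z'.
Proof.
move=> ej ez; split=> symz t h.
  rewrite -(mmap_rmorph h ej ez) => /eqP; rewrite fmorph_eq0 => /eqP/(symz t) h0.
  by rewrite -(mmap_rmorph h ej (fun i => ez (t i))) h0 rmorph0.
move=> h0; apply: (fmorph_inj e); rewrite rmorph0.
rewrite (mmap_rmorph h ej (fun i => ez (t i))); apply: symz.
by rewrite -(mmap_rmorph h ej ez) h0 rmorph0.
Qed.

Section GaloisSym.
Variables (K : fieldType) (ch0 : [pchar K] =i pred0) (N : splittingFieldType K).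
Variables (d : nat) (rs : 'I_d -> N) (q : {poly K}) (c : K).
Hypotheses (rs_inj : injective rs) (c_neq0 : c != 0)
  (Dq : map_poly (in_alg N) q = c%:A *: \prod_i ('X - (rs i)%:P))
  (rs_sym : symmetric_relations (in_alg N) rs).

Lemma root_rs_lead : c%:A != 0 :> N.
Proof. by rewrite scaler_eq0 oner_eq0 orbF. Qed.

Lemma root_rs x : root (map_poly (in_alg N) q) x -> exists j, x = rs j.
Proof.
rewrite Dq rootZ ?root_rs_lead // /root horner_prod prodf_seq_eq0 => /hasP[j _].
by rewrite !hornerE /= subr_eq0 => /eqP->; exists j.
Qed.

Lemma gal_map_alg (g : gal_of {:N}) (p : {poly K}) (x : N) :
  g (map_poly (in_alg N) p).[x] = (map_poly (in_alg N) p).[g x].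
Proof.
rewrite -horner_map -map_poly_comp /=; congr _.[_].
by apply: eq_map_poly => a /=; rewrite linearZ /= rmorph1.
Qed.

Lemma gal_rs (g : gal_of {:N}) i : exists j, g (rs i) = rs j.
Proof.
apply: root_rs; rewrite /root -gal_map_alg.
suffices /rootP-> : root (map_poly (in_alg N) q) (rs i) by rewrite rmorph0.
rewrite Dq rootZ ?root_rs_lead // /root horner_prod; apply/prodf_eq0; exists i => //.
by rewrite !hornerE subrr.
Qed.

Definition root_act (g : gal_of {:N}) i := odflt i [pick j | rs j == g (rs i)].

Lemma root_actE g i : rs (root_act g i) = g (rs i).
Proof.
rewrite /root_act; case: pickP => [j /eqP // | no].
by have [j Dj] := gal_rs g i; have := no j; rewrite Dj eqxx.
Qed.

Lemma root_act_inj g : injective (root_act g).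
Proof.
move=> i j eq_ij; have: g (rs i) = g (rs j) by rewrite -!root_actE eq_ij.
by move/fmorph_inj/rs_inj.
Qed.

Definition root_perm g : 'S_d := perm (@root_act_inj g).

Lemma root_permE g i : rs (root_perm g i) = g (rs i).
Proof. by rewrite permE root_actE. Qed.

Lemma root_permM : {in 'Gal({:N} / 1)%g &, {morph root_perm : g h / (g * h)%g}}.
Proof.
move=> g h _ _; apply/permP=> i; apply: rs_inj.
by rewrite permM !root_permE galM ?memvf.
Qed.

Canonical root_morphism := Morphism root_permM.

Lemma PET_roots : exists (a : 'I_d -> nat) (p : 'I_d -> {poly K}),
  forall i, rs i = (map_poly (in_alg N) (p i)).[\sum_l rs l *+ a l].
Proof.
pose s := [seq rs i | i <- enum 'I_d].
have szs : size s = d by rewrite size_map size_enum_ord.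
have alg_s x : x \in s -> algebraicOver (in_alg N) x.
  case/mapP=> i _ ->; exists q; last first.
    rewrite Dq rootZ ?root_rs_lead // /root horner_prod; apply/prodf_eq0.
    by exists i; rewrite // !hornerE subrr.
  rewrite -(map_poly_eq0 (in_alg N)) Dq scaler_eq0 (negPf root_rs_lead) /=.
  by apply/prodf_neq0 => j _; rewrite polyXsubC_eq0.
have s_i (i : 'I_d) : s`_i = rs i.
  by rewrite (nth_map i) ?size_enum_ord // nth_ord_enum.
have [z [_ [a Dz] [ps Ds]]] := PET_seq ch0 alg_s.
have {}Dz : z = \sum_l rs l *+ a l.
  rewrite Dz -(big_mkord xpredT (fun i => s`_i *+ a i)) szs big_mkord.
  by apply: eq_bigr => i _; rewrite s_i.
exists a, (fun i => ps`_i) => i; rewrite -s_i -Dz {1}Ds (nth_map 0) //.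
by rewrite -(size_map (fun p => (map_poly (in_alg N) p).[z])) -Ds szs.
Qed.

(** The minimal polynomial of the primitive element [z], evaluated at the combination of the roots
    that defines [z], is a relation between them. Permuting it by [t] shows that [zt] is a conjugate
    of [z]; the automorphism that sends [z] to [zt] induces [t]. *)
Lemma root_perm_onto t : exists2 g, g \in 'Gal({:N} / 1)%g & root_perm g = t.
Proof.
have [a [p Drs]] := PET_roots; set z := \sum_l _ in Drs.
pose zX : {mpoly K[d]} := \sum_l 'X_l *+ a l.
pose zt := \sum_l rs (t l) *+ a l.
have mmap_zX (w : 'I_d -> N) : mmap (in_alg N) w zX = \sum_l w l *+ a l.
  by rewrite rmorph_sum; apply: eq_bigr => l _; rewrite rmorphMn /= mmapX mmap1U.
have mmap_pzX (w : 'I_d -> N) f : mmap (in_alg N) w (map_poly (@mpolyC d K) f).[zX]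
   = (map_poly (in_alg N) f).[\sum_l w l *+ a l].
  rewrite -horner_map /= mmap_zX -map_poly_comp; congr _.[_].
  by apply: eq_map_poly => b /=; rewrite mmapC.
have [f Df] : exists f, minPoly 1%AS z = map_poly (in_alg N) f.
  have /polyOver1P[f Df] := minPolyOver 1%AS z; by exists f.
have zt_root : root (minPoly 1%AS z) zt.
  apply/rootP; rewrite Df -mmap_pzX; apply: rs_sym.
  by rewrite mmap_pzX -/z -Df; apply: minPolyxx.
have [g Gg gz] := normalField_root_minPoly (sub1v _) (normalFieldf _) (memvf z) zt_root.
exists g => //; apply/permP=> i; apply: rs_inj; rewrite root_permE.
rewrite Drs gal_map_alg gz -/z; apply/eqP; rewrite -subr_eq0.
(* The relation that expresses the root of index [i] as a polynomial [p i] in [z] is permuted too,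
   so [p i] takes [zt] to [rs (t i)]. *)
have := @rs_sym t ((map_poly (@mpolyC d K) (p i)).[zX] - 'X_i).
rewrite !raddfB /= !mmap_pzX -/z -/zt !mmapX !mmap1U -Drs subrr.
by move->.
Qed.

Lemma root_perm_surj : (root_perm @* 'Gal({:N} / 1) = [set: 'S_d])%g.
Proof.
apply/setP=> t; rewrite !inE; have [g Gg <-] := root_perm_onto t.
exact: (mem_morphim root_morphism).
Qed.

Lemma gal_isog_Sym :
  <<1 & codom rs>>%VS = {:N}%VS -> ('Gal({:N} / 1) \isog [set: 'S_d])%g.
Proof.
move=> genN; apply/isogP; exists root_morphism; last exact: root_perm_surj.
apply/injmP=> g h Gg Gh eq_gh; apply/eqP/gal_eqP => x _.
have eq_rp : root_perm g = root_perm h := eq_gh.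
have {}eq_gh i : g (rs i) = h (rs i) by rewrite -!root_permE eq_rp.
apply: (@seq_adjoin_sub _ _ _ idfun (fun x => g x = h x) (codom rs)) => //.
- split=> [|y z gy gz|y z gy gz]; first by rewrite !rmorph1.
    by rewrite /= !linearB; congr (_ - _).
  by rewrite /= !fmorph_div; congr (_ / _).
- by move=> a /=; rewrite !linearZ /= !rmorph1.
- by move=> _ /codomP[i ->] /=; apply: eq_gh.
- by rewrite genN memvf.
Qed.
End GaloisSym.

(** * Radical towers *)

Lemma radical_extension_subfield (M : fieldType) (F E : M -> Prop) :
  is_subfield F -> radical_extension F E -> is_subfield E /\ (forall x, F x -> E x).
Proof.
move=> sfF; elim=> [//|{}E a m _ [sfE sFE] _ _].
split; first exact: adjoin_subfield.
by move=> x Fx; apply: adjoin_base; apply: sFE.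
Qed.

Section DerivedFixed.
Variables (K : fieldType) (N : splittingFieldType K).
Local Notation G := ('Gal({:N} / 1))%g.

(** Every commutator fixes [x], and the stabilizer of [x] is a group, so it contains all that the
    commutators generate. *)
Lemma derived_fix (H : {group gal_of {:N}}) x :
  {in H &, forall g h : gal_of {:N}, g (h x) = h (g x)} ->
  {in H^`(1)%g, forall g : gal_of {:N}, g x = x}.
Proof.
move=> comH; pose S := [set g : gal_of {:N} | g x == x].
have gS : group_set S.
  apply/group_setP; split=> [|g h]; first by rewrite inE gal_id.
  by rewrite !inE galM ?memvf // => /eqP-> /eqP->.
suffices: (H^`(1) \subset Group gS)%g.
  by move/subsetP=> sHS g /sHS; rewrite inE => /eqP.
rewrite derg1 gen_subG; apply/subsetP=> _ /imset2P[g h Hg Hh ->].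
rewrite inE commgEl /conjg !galM ?memvf //.
rewrite comH ?groupV // -(galM g^-1%g g) ?memvf // mulVg gal_id.
by rewrite -(galM h^-1%g h) ?memvf // mulVg gal_id.
Qed.

(** Each automorphism raises [z] to some power, and taking powers commutes. *)
Lemma gal_unity_comm (g h : gal_of {:N}) z m :
  (0 < m)%N -> z ^+ m = 1 -> g (h z) = h (g z).
Proof.
move=> m_gt0 zm1; have [m' prim_z _] := prim_order_exists m_gt0 zm1.
have pow (f : gal_of {:N}) : exists i, f z = z ^+ i.
  have [|i Di] := prim_rootP prim_z (x := f z); last by exists i.
  by rewrite -rmorphXn prim_expr_order //= rmorph1.
have [[i Di] [j Dj]] := (pow g, pow h).
by rewrite Di Dj !rmorphXn /= Di Dj -!exprM mulnC.
Qed.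

Definition fixed_img (M : fieldType) (e : {rmorphism N -> M})
    (H : {set gal_of {:N}}) (y : M) :=
  exists2 x, y = e x & {in H, forall g : gal_of {:N}, g x = x}.

Lemma fixed_img_subfield (M : fieldType) (e : {rmorphism N -> M}) (H : {set gal_of {:N}}) :
  is_subfield (fixed_img e H).
Proof.
split=> [|_ _ [x -> fx] [y -> fy]|_ _ [x -> fx] [y -> fy]].
- by exists 1 => [|g _]; rewrite rmorph1.
- by exists (x - y) => [|g Hg]; rewrite /= ?rmorphB //= fx ?fy.
- by exists (x / y) => [|g Hg]; rewrite /= fmorph_div //= fx ?fy.
Qed.

Lemma fixed_imgS (M : fieldType) (e : {rmorphism N -> M}) (H H' : {set gal_of {:N}}) y :
  H' \subset H -> fixed_img e H y -> fixed_img e H' y.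
Proof. by move/subsetP=> sH [x -> fx]; exists x => // g /sH/fx. Qed.

(* For g in the i-th derived subgroup, g a / a is an m-th root of unity;
   automorphisms commute on roots of unity, so one more commutator subgroup
   fixes these and the next one fixes a. *)
Lemma radical_fixed_step (M : fieldType) (e : {rmorphism N -> M}) i (a : N) m :
    (0 < m)%N -> fixed_img e G^`(i)%g (e a ^+ m) ->
  fixed_img e G^`(i.+2)%g (e a).
Proof.
move=> m_gt0 [x /esym/eqP]; rewrite -rmorphXn fmorph_eq => /eqP Dx fx.
have fx' : {in G^`(i.+1)%g, forall g : gal_of {:N}, g x = x}.
  by move=> g /(subsetP (der_sub 1 G^`(i)))/fx.
exists a => //; apply: derived_fix => g h Gg Gh.
have [->|nz_a] := eqVneq a 0; first by rewrite !rmorph0.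
have [zg [Dg zg1]] : exists z, g a = z * a /\ z ^+ m = 1.
  exists (g a / a); rewrite divfK // expr_div_n -rmorphXn -Dx /= fx' // divff //.
  by rewrite Dx expf_neq0.
have [zh [Dh zh1]] : exists z, h a = z * a /\ z ^+ m = 1.
  exists (h a / a); rewrite divfK // expr_div_n -rmorphXn -Dx /= fx' // divff //.
  by rewrite Dx expf_neq0.
have fz (f : gal_of {:N}) z : f \in G^`(i.+1)%g -> z ^+ m = 1 -> f z = z.
  move=> Gf zm1; apply: (@derived_fix ('Gal({:N} / 1))%G); last first.
    by apply: subsetP Gf; rewrite dergSn derg1 commgSS ?der_sub.
  by move=> f1 f2 _ _; apply: gal_unity_comm zm1.
by rewrite Dh Dg !rmorphM /= Dh Dg !fz // mulrCA.
Qed.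
End DerivedFixed.

(** All roots of one polynomial that kills the elements of [s] are adjoined, which makes the
    extension normal. *)
Lemma splitting_embed (K : fieldType) (Kbar : closedFieldType)
    (iota : {rmorphism K -> Kbar}) (s : seq Kbar) :
    [pchar K] =i pred0 -> (forall x, x \in s -> algebraicOver iota x) ->
  exists (N : splittingFieldType K) (e : {rmorphism N -> Kbar}),
    (forall c, e c%:A = iota c) /\ (forall x, x \in s -> exists y, x = e y).
Proof.
move=> ch0 algs.
have [q nz_q qs] : exists2 q : {poly K}, q != 0 & forall x, x \in s -> root (map_poly iota q) x.
  elim: s algs => [_|x s IH algs]; first by exists 1; rewrite ?oner_neq0.
  have [p nz_p px] := algs x (mem_head _ _).
  have [y sy|q nz_q qs] := IH; first by apply: algs; rewrite inE sy orbT.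
  exists (p * q); first by rewrite mulf_neq0.
  move=> y; rewrite inE rmorphM rootM => /predU1P[->|/qs->]; last by rewrite orbT.
  by rewrite px.
have [r Dr] := closed_field_poly_normal (map_poly iota q).
have alg_r x : x \in r -> algebraicOver iota x.
  move=> rx; exists q => //; rewrite Dr rootZ ?root_prod_XsubC //.
  by rewrite lead_coef_eq0 map_poly_eq0.
have [L [e [s1 [eC es1 genL]]]] := fieldExt_generated ch0 alg_r.
have Dq : map_poly (in_alg L) q = (lead_coef q)%:A *: \prod_(x <- s1) ('X - x%:P).
  apply: (map_poly_inj e); rewrite map_polyZ rmorph_prod /= -map_poly_comp.
  rewrite (eq_map_poly (g := iota)) => [|a /=]; last exact: eC.
  rewrite Dr lead_coef_map eC -es1 big_map; congr (_ *: _).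
  by apply: eq_bigr => x _; rewrite rmorphB /= map_polyX map_polyC.
have axL : SplittingField.axiom L.
  exists (map_poly (in_alg L) q); first exact: alg_polyOver.
  exists s1 => //; rewrite Dq eqp_scale //.
  by rewrite scaler_eq0 oner_eq0 orbF lead_coef_eq0.
pose N : splittingFieldType K := HB.pack L (FieldExt_isSplittingField.Build K L axL).
exists N, e; split=> // x /qs.
rewrite Dr rootZ ?lead_coef_eq0 ?map_poly_eq0 // root_prod_XsubC -es1.
by case/mapP=> y _ ->; exists y.
Qed.

Lemma der_series_leq (gT : finGroupType) (G : {group gT}) i j :
  (i <= j)%N -> (G^`(j) \subset G^`(i))%g.
Proof.
move/subnK <-; elim: (j - i)%N => // l IH.
exact: subset_trans (der_sub 1 _) IH.
Qed.

Section Insolvability.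
Variables (K : fieldType) (Kbar : closedFieldType) (iota : {rmorphism K -> Kbar}).
Hypotheses (ch0 : [pchar K] =i pred0) (hKbar : is_algebraic_closure iota).

(** Quantifying over every normal [N] that contains [s] makes the property stable under enlarging
    [s]: several towers, each with its own radicals listed in [s], can be handled in one common
    [N]. *)
Definition eventually_fixed (S : Kbar -> Prop) (s : seq Kbar) :=
  forall (N : splittingFieldType K) (e : {rmorphism N -> Kbar}),
    (forall c, e c%:A = iota c) -> (forall x, x \in s -> exists y, x = e y) ->
  exists i, forall y, S y -> fixed_img e ('Gal({:N} / 1))^`(i)%g y.

Lemma radical_eventually_fixed E :
  radical_extension (img iota) E -> exists s, eventually_fixed E s.
Proof.
elim=> [|{}E a m radE [s fixE] m_gt0 Eam].
  exists [::] => N e eC _; exists 0%N => _ [c ->]; exists c%:A => // g _.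
  by rewrite linearZ /= rmorph1.
exists (a :: s) => N e eC es.
have [i fixi] : exists i, forall y, E y -> fixed_img e ('Gal({:N} / 1))^`(i)%g y.
  by apply: fixE => // x sx; apply: es; rewrite inE sx orbT.
exists i.+2; apply: adjoin_sub; first exact: fixed_img_subfield.
  by move=> y /fixi; apply: fixed_imgS; apply: der_series_leq; rewrite -addn2 leq_addr.
move=> _ ->; have [b Db] := es a (mem_head _ _).
by rewrite Db; apply: radical_fixed_step m_gt0 _; rewrite -Db; apply: fixi.
Qed.

Lemma radicals_eventually_fixed (Y : seq Kbar) :
  (forall y, y \in Y -> exists2 R, radical_extension (img iota) R & R y) ->
  exists s, eventually_fixed (fun y => y \in Y) s.
Proof.
elim: Y => [_|y Y IH radY]; first by exists [::] => N e _ _; exists 0%N.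
have [|s1 fix1] := IH; first by move=> x Yx; apply: radY; rewrite inE Yx orbT.
have [R radR Ry] := radY y (mem_head _ _).
have [s2 fix2] := radical_eventually_fixed radR.
exists (s1 ++ s2) => N e eC es.
have [|i1 fixi1] := fix1 N e eC.
  by move=> x sx; apply: es; rewrite mem_cat sx.
have [|i2 fixi2] := fix2 N e eC.
  by move=> x sx; apply: es; rewrite mem_cat sx orbT.
exists (maxn i1 i2) => x; rewrite inE => /predU1P[->|Yx].
  by apply: fixed_imgS (fixi2 _ Ry); rewrite der_series_leq ?leq_maxr.
by apply: fixed_imgS (fixi1 _ Yx); rewrite der_series_leq ?leq_maxl.
Qed.

(** Only the elements of [Y], later the entries of the solutions, are assumed radical; the last
    hypothesis then brings the roots into the fixed field of a derived subgroup. As the Galois group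
    maps onto S_d, some derived subgroup of S_d is trivial, which is impossible for d > 4 since the
    alternating group is not solvable. *)
Lemma symmetric_roots_radical (d : nat) (z : 'I_d -> Kbar) (q : {poly K}) c
    (Y : seq Kbar) :
    injective z -> c != 0 ->
    map_poly iota q = iota c *: \prod_i ('X - (z i)%:P) ->
    symmetric_relations iota z ->
    (forall y, y \in Y -> exists2 R, radical_extension (img iota) R & R y) ->
    (forall E, is_subfield E -> (forall x, E (iota x)) ->
       (forall y, y \in Y -> E y) -> forall i, E (z i)) ->
  (d <= 4)%N.
Proof.
move=> z_inj nz_c Dq z_sym radY genY; rewrite leqNgt; apply/negP=> d_gt4.
have [s fixs] := radicals_eventually_fixed radY.
have [N [e [eC es]]] : exists (N : splittingFieldType K) (e : {rmorphism N -> Kbar}),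
    (forall c, e c%:A = iota c) /\ (forall x, x \in s ++ codom z -> exists y, x = e y).
  by apply: splitting_embed => // x _; apply: hKbar.
have [|i fixi] := fixs N e eC.
  by move=> x sx; apply: es; rewrite mem_cat sx.
have lift_z l : {r | e r == z l}.
  apply: sigW; have [|r ->] := es (z l); last by exists r.
  by rewrite mem_cat codom_f orbT.
pose rs l := sval (lift_z l).
have ers l : e (rs l) = z l by apply/eqP/(svalP (lift_z l)).
have rs_inj : injective rs by move=> l m /(congr1 e); rewrite !ers => /z_inj.
have DqN : map_poly (in_alg N) q = c%:A *: \prod_l ('X - (rs l)%:P).
  apply: (map_poly_inj e); rewrite map_polyZ rmorph_prod /= -map_poly_comp.
  rewrite (eq_map_poly (g := iota)) => [|a /=]; last exact: eC.
  rewrite Dq eC; congr (_ *: _).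
  by apply: eq_bigr => l _; rewrite rmorphB /= map_polyX map_polyC /= ers.
have rs_sym : symmetric_relations (in_alg N) rs.
  exact: (iffRL (@symmetric_relations_rmorph _ _ _ (in_alg N) e iota _ _ _ eC ers)).
have fix_rs l : {in ('Gal({:N} / 1))^`(i)%g, forall g : gal_of {:N}, g (rs l) = rs l}.
  have [x|r Dr fixr] := genY _ (fixed_img_subfield e (('Gal({:N} / 1))^`(i))%g) _ fixi l.
    by exists x%:A => // g _; rewrite linearZ /= rmorph1.
  move=> g Gg; suffices -> : rs l = r by apply: fixr.
  by apply: (fmorph_inj e); rewrite ers.
pose f := root_morphism rs_inj nz_c DqN.
have surj_f : (f @* 'Gal({:N} / 1) = [set: 'S_d])%g.
  exact: (@root_perm_surj _ ch0 _ _ _ _ _ rs_inj nz_c DqN rs_sym).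
have der1 : ([set: 'S_d]^`(i) \subset [1])%g.
  rewrite -surj_f -morphim_der //.
  apply/subsetP=> _ /morphimP[g _ Gg ->]; apply/set1P/permP=> l.
  by apply: (@rs_inj); rewrite perm1 root_permE fix_rs.
have: solvable 'Alt_('I_d).
  apply: (solvableS (G := [group of [set: 'S_d]])); first exact: subsetT.
  by apply/derivedP; exists i; apply/trivgP.
by rewrite solvable_AltF // card_ord.
Qed.
End Insolvability.

(** * Matrix pencils and their eigenpairs *)

Definition pencil (R : comNzRingType) (k n : nat) (A : 'I_k.+1 -> 'M[R]_n) (x : R) : 'M[R]_n :=
  \sum_(r < k.+1) x ^+ r *: A r.

Definition pencil_det (R : comNzRingType) (k n : nat) (A : 'I_k.+1 -> 'M[R]_n) : {poly R} :=
  \det (pencil (fun r => map_mx (@polyC R) (A r)) 'X).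

Lemma map_pencil (R S : comNzRingType) (f : {rmorphism R -> S}) k n
    (A : 'I_k.+1 -> 'M[R]_n) x :
  map_mx f (pencil A x) = pencil (fun r => map_mx f (A r)) (f x).
Proof. by rewrite /pencil raddf_sum; apply: eq_bigr => r _; rewrite /= map_mxZ rmorphXn. Qed.

Lemma horner_pencil_det (R : comNzRingType) k n (A : 'I_k.+1 -> 'M[R]_n) x :
  (pencil_det A).[x] = \det (pencil A x).
Proof.
rewrite -[_.[x]]/(horner_eval x _) -det_map_mx map_pencil /= /horner_eval hornerX.
congr (\det _); apply: eq_bigr => r _; congr (_ *: _).
by apply/matrixP=> i j; rewrite !mxE hornerC.
Qed.

Lemma map_pencil_det (R S : comNzRingType) (f : {rmorphism R -> S}) k n
    (A : 'I_k.+1 -> 'M[R]_n) :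
  map_poly f (pencil_det A) = pencil_det (fun r => map_mx f (A r)).
Proof.
rewrite -det_map_mx (map_pencil (map_poly f)) /= map_polyX; congr (\det _).
apply: eq_bigr => r _; congr (_ *: _).
by apply/matrixP=> i j; rewrite !mxE map_polyC.
Qed.

Lemma coef_top_mul (R : comNzRingType) (p q : {poly R}) a b :
    (size p <= a.+1)%N -> (size q <= b.+1)%N ->
  (size (p * q)%R <= (a + b).+1)%N /\ (p * q)`_(a + b) = p`_a * q`_b.
Proof.
move=> sp sq; split.
  apply: leq_trans (size_polyMleq _ _) _.
  by rewrite -subn1 leq_subLR add1n -addnS -addSn leq_add.
have lta : (a < (a + b).+1)%N by rewrite ltnS leq_addr.
rewrite coefM (bigD1 (Ordinal lta)) //= addKn big1 ?addr0 // => i.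
rewrite -val_eqE /= neq_ltn => /orP[ltia|ltai].
  rewrite [q`__]nth_default ?mulr0 //; apply: leq_trans sq _.
  by rewrite ltn_subRL ltn_add2r.
by rewrite nth_default ?mul0r // (leq_trans sp).
Qed.

(** In the Leibniz expansion each product of n entries has degree at most kn, and its coefficient
    there is the product of the corresponding entries of the top matrix. *)
Lemma pencil_det_top (R : comNzRingType) k n (A : 'I_k.+1 -> 'M[R]_n) :
  (size (pencil_det A) <= (k * n).+1)%N /\ (pencil_det A)`_(k * n) = \det (A ord_max).
Proof.
have entryE i j : pencil (fun r => map_mx (@polyC R) (A r)) 'X i j
    = \poly_(r < k.+1) A (inord r) i j.
  rewrite poly_def summxE; apply: eq_bigr => r _.
  by rewrite !mxE inord_val -mul_polyC mulrC.
have topE (s : 'S_n) (l : seq 'I_n) :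
   (size (\prod_(i <- l) pencil (fun r => map_mx (@polyC R) (A r)) 'X i (s i))%R
      <= (k * size l).+1)%N /\
   (\prod_(i <- l) pencil (fun r => map_mx (@polyC R) (A r)) 'X i (s i))`_(k * size l)
      = \prod_(i <- l) A ord_max i (s i).
  elim: l => [|i l [IHs IHc]].
    by rewrite !big_nil /= muln0 coef1 size_poly1.
  rewrite !big_cons -IHc /= mulnS.
  have szi : (size (pencil (fun r => map_mx (@polyC R) (A r)) 'X i (s i)) <= k.+1)%N.
    by rewrite entryE size_poly.
  have [-> ->] := coef_top_mul szi IHs.
  split=> //; congr (_ * _); rewrite entryE coef_poly ltnSn.
  by congr (A _ _ _); apply: val_inj; rewrite /= inordK.
have {}topE (s : 'S_n) := topE s (index_enum 'I_n).
have sz_enum : size (index_enum 'I_n) = n.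
  by rewrite -[RHS](size_enum_ord n) enumT.
rewrite sz_enum in topE.
have signE (s : 'S_n) : (-1) ^+ s = ((-1) ^+ s)%:P :> {poly R}.
  by rewrite rmorphXn rmorphN rmorph1.
split.
  apply: leq_trans (size_sum _ _ _) _; apply/bigmax_leqP => s _.
  rewrite signE mul_polyC; apply: leq_trans (size_scale_leq _ _) _.
  by have [] := topE s.
rewrite coef_sum; apply: eq_bigr => s _.
by rewrite signE mul_polyC coefZ; have [_ ->] := topE s.
Qed.

(* The columns of the block Vandermonde matrix are the (x_i ^ r v_i)_(r < k). *)
Definition block_vander (R : comNzRingType) (k n d : nat) (x : 'I_d -> R)
    (v : 'I_d -> 'cV[R]_n) : 'M[R]_(k * n, d) :=
  \matrix_(a, i) mxvec (\matrix_(r < k, j < n) (x i ^+ r * v i j 0)) 0 a.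

Lemma block_vanderE (R : comNzRingType) k n d (x : 'I_d -> R) (v : 'I_d -> 'cV[R]_n)
    (r : 'I_k) (j : 'I_n) i :
  block_vander k x v (mxvec_index r j) i = x i ^+ r * v i j 0.
Proof. by rewrite !mxE mxvecE !mxE. Qed.

Lemma map_block_vander (R S : comNzRingType) (f : {rmorphism R -> S}) k n d
    (x : 'I_d -> R) (v : 'I_d -> 'cV[R]_n) :
  map_mx f (block_vander k x v) = block_vander k (fun i => f (x i)) (fun i => map_mx f (v i)).
Proof.
apply/matrixP=> a i; case/mxvec_indexP: a => r j.
by rewrite mxE !block_vanderE mxE rmorphM rmorphXn.
Qed.

Lemma sum_mxvec_index (V : nmodType) m n (f : 'I_(m * n) -> V) :
  \sum_a f a = \sum_(i < m) \sum_(j < n) f (mxvec_index i j).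
Proof.
rewrite pair_bigA /= (reindex _ (curry_mxvec_bij _ _)).
by apply: eq_bigr => -[i j] _.
Qed.

(** The difference of the two pencils has degree less than k; its coefficients side by side form a
    matrix [E] whose product with the block Vandermonde matrix is 0. *)
Lemma pencil_uniq (R : comUnitRingType) k n (x : 'I_(k * n) -> R)
    (v : 'I_(k * n) -> 'cV[R]_n) (A A' : 'I_k.+1 -> 'M[R]_n) :
    block_vander k x v \in unitmx ->
    (forall i, pencil A (x i) *m v i = 0) -> (forall i, pencil A' (x i) *m v i = 0) ->
    A ord_max = A' ord_max ->
  forall r, A r = A' r.
Proof.
move=> unitW Av A'v eq_top.
pose D r := A (widen_ord (leqnSn k) r) - A' (widen_ord (leqnSn k) r).
pose E : 'M[R]_(n, k * n) :=
  \matrix_(a, b) mxvec (\matrix_(r < k, j < n) D r a j) 0 b.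
have EW0 : E *m block_vander k x v = 0.
  apply/matrixP=> a i; rewrite !mxE sum_mxvec_index.
  have := congr2 (fun P Q : 'cV_n => (P - Q) a 0) (Av i) (A'v i).
  rewrite !mulmx_suml -sumrB big_ord_recr /= -!scalemxAl eq_top subrr addr0.
  rewrite subr0 mxE summxE => eq0; rewrite -[RHS]eq0; apply: eq_bigr => r _.
  rewrite -!scalemxAl -scalerBr -mulmxBl !mxE mulr_sumr; apply: eq_bigr => j _.
  by rewrite block_vanderE mxE mxvecE !mxE mulrCA.
have E0 : E = 0 by rewrite -[E](mulmxK unitW) EW0 mul0mx.
move=> r; have [ltrk|gerk] := ltnP r k; last first.
  suffices -> : r = ord_max by [].
  by apply/val_inj/eqP; rewrite eqn_leq gerk -ltnS ltn_ord.
apply/eqP; rewrite -subr_eq0; apply/eqP/matrixP=> a j.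
have /matrixP/(_ a (mxvec_index (Ordinal ltrk) j)) := E0.
rewrite !mxE mxvecE !mxE => <-.
by congr (A _ _ _ - A' _ _ _); apply: val_inj.
Qed.

Lemma big_option (V : nmodType) (I : finType) (f : option I -> V) :
  \sum_o f o = f None + \sum_i f (Some i).
Proof.
rewrite (bigD1 None) //=; congr (_ + _).
by rewrite (reindex_omap Some id) => [|[]] //=; apply: eq_bigl => i; rewrite eqxx.
Qed.

Lemma pencil_ker (F : fieldType) k n (A : 'I_k.+1 -> 'M[F]_n) y : \det (pencil A y) = 0 ->
  {w : 'cV_n | (w != 0) && (pencil A y *m w == 0)}.
Proof.
move=> det0; apply: sigW; move/eqP: det0; rewrite -det_tr => /det0P[w nz_w Aw].
exists w^T; rewrite trmx_eq0 nz_w.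
by rewrite -[pencil _ _]trmxK -trmx_mul Aw trmx0 eqxx.
Qed.

Lemma separable_linear_factors (F : fieldType) d (x : 'I_d -> F) c :
  c != 0 -> injective x -> separable_poly (c *: \prod_i ('X - (x i)%:P)).
Proof.
move=> nz_c x_inj; rewrite separable_poly.unlock derivZ coprimepZl // coprimepZr //.
have -> : \prod_i ('X - (x i)%:P) = \prod_(y <- codom x) ('X - y%:P) by rewrite big_image.
have := separable_prod_XsubC (codom x); rewrite separable_poly.unlock => ->.
exact/injectiveP.
Qed.

Section EigenPairs.
Variables (F : fieldType) (k n : nat) (A : 'I_k.+1 -> 'M[F]_n).
Hypothesis unitAk : A ord_max \in unitmx.

(** As the leading coefficient is invertible, each pencil equation expresses [x i ^+ k *: v i]
    through lower powers, by matrices that do not depend on [i]; the relations for exponents below k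
    thus propagate to all exponents. The index type is left free so that one more pair can be added
    to a family. *)
Lemma eigen_shift (I : finType) (x : I -> F) (v : I -> 'cV[F]_n) (c : I -> F) :
    (forall i, pencil A (x i) *m v i = 0) ->
    (forall r, (r < k)%N -> \sum_i (c i * x i ^+ r) *: v i = 0) ->
  forall p : {poly F}, \sum_i (c i * p.[x i]) *: v i = 0.
Proof.
move=> Av cv0.
have {}cv0 r : \sum_i (c i * x i ^+ r) *: v i = 0.
  elim/ltn_ind: r => r IH; have [|lekr] := ltnP r k; first exact: cv0.
  pose s := (r - k)%N; have Dr : r = (s + k)%N by rewrite subnK.
  apply: (can_inj (mulKmx unitAk)); rewrite mulmx0 mulmx_sumr.
  have Akv i : A ord_max *m ((c i * x i ^+ r) *: v i)
      = - \sum_(l < k) A (widen_ord (leqnSn k) l) *m ((c i * x i ^+ (s + l)) *: v i).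
    have /(congr1 (fun u => (c i * x i ^+ s) *: u)) := Av i.
    rewrite scaler0 mulmx_suml big_ord_recr /= scalerDr => /eqP.
    rewrite addrC addr_eq0 => /eqP; rewrite -scalemxAl scalerA -mulrA -exprD -Dr.
    rewrite scalemxAr => ->; congr (- _); rewrite scaler_sumr.
    by apply: eq_bigr => l _; rewrite -scalemxAl scalerA -mulrA -exprD scalemxAr.
  rewrite (eq_bigr _ (fun i _ => Akv i)) sumrN exchange_big big1 ?oppr0 // => l _.
  by rewrite -mulmx_sumr IH ?mulmx0 // Dr ltn_add2l.
move=> p; rewrite (eq_bigr (fun i => \sum_(r < size p) p`_r *: ((c i * x i ^+ r) *: v i))).
  by rewrite exchange_big big1 // => r _; rewrite -scaler_sumr cv0 scaler0.
move=> i _; rewrite horner_coef mulr_sumr scaler_suml; apply: eq_bigr => r _.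
by rewrite scalerA mulrCA.
Qed.

Variables (d : nat) (x : 'I_d -> F) (v : 'I_d -> 'cV[F]_n).
Hypotheses (x_inj : injective x) (nz_v : forall i, v i != 0)
  (Av : forall i, pencil A (x i) *m v i = 0).

(** Lagrange polynomial up to a scalar: put into [eigen_shift], it isolates the term of index
    [i]. *)
Definition others i : {poly F} := \prod_(j | j != i) ('X - (x j)%:P).

Lemma others_self i : (others i).[x i] != 0.
Proof.
rewrite horner_prod; apply/prodf_neq0 => j ji.
by rewrite !hornerE subr_eq0 (inj_eq x_inj) eq_sym.
Qed.

Lemma others_other i j : j != i -> (others i).[x j] = 0.
Proof. by move=> ji; rewrite horner_prod (bigD1 j) //= !hornerE subrr mul0r. Qed.

Lemma block_vander_ker (c : 'cV[F]_d) : block_vander k x v *m c = 0 -> c = 0.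
Proof.
move=> Wc0; have cv0 := @eigen_shift _ x v (fun i => c i 0) Av.
apply/colP=> i; rewrite mxE; apply/eqP.
have /cv0/(_ (others i))/eqP : forall r, (r < k)%N -> \sum_i (c i 0 * x i ^+ r) *: v i = 0.
  move=> r rk; apply/colP=> j; have /matrixP/(_ (mxvec_index (Ordinal rk) j) 0) := Wc0.
  rewrite !mxE => eq0; rewrite summxE -[RHS]eq0; apply: eq_bigr => l _.
  by rewrite block_vanderE mxE [RHS]mulrC mulrA.
rewrite (bigD1 i) //= big1 ?addr0 => [|j ji]; last by rewrite others_other // mulr0 scale0r.
by rewrite scaler_eq0 (negPf (nz_v i)) orbF mulf_eq0 (negPf (others_self i)) orbF.
Qed.
End EigenPairs.

Section EigenBasis.
Variables (F : fieldType) (k n : nat) (A : 'I_k.+1 -> 'M[F]_n).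
Variables (x : 'I_(k * n) -> F) (v : 'I_(k * n) -> 'cV[F]_n).
Hypotheses (unitAk : A ord_max \in unitmx)
  (x_inj : injective x) (nz_v : forall i, v i != 0)
  (Av : forall i, pencil A (x i) *m v i = 0).

Lemma block_vander_unit : block_vander k x v \in unitmx.
Proof.
rewrite -unitmx_tr -row_free_unit; apply: inj_row_free => c cW0.
rewrite -[c]trmxK (block_vander_ker unitAk x_inj nz_v Av (c := c^T)) ?trmx0 //.
by rewrite -[LHS]trmxK trmx_mul trmxK cW0 trmx0.
Qed.

(** The pair [(x i, w)] joins the family as index [None], with coefficient -1. Its column is a
    combination [c] of the columns of the invertible block Vandermonde matrix, and testing this
    relation with [others x i] leaves only the terms in [w] and [v i]. *)
Lemma eigen_line i (w : 'cV[F]_n) : pencil A (x i) *m w = 0 -> exists b, w = b *: v i.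
Proof.
move=> Aw.
pose y : 'cV[F]_(k * n) := \col_a mxvec (\matrix_(r < k, j < n) (x i ^+ r * w j 0)) 0 a.
pose c := invmx (block_vander k x v) *m y.
have Wc : block_vander k x v *m c = y by rewrite mulKVmx ?block_vander_unit.
exists (c i 0).
have Ave (o : option 'I_(k * n)) :
    pencil A (oapp x (x i) o) *m oapp v w o = 0 by case: o.
pose ce := oapp (fun j => c j 0) (-1).
have /(eigen_shift unitAk Ave)/(_ (others x i))/eqP : forall r, (r < k)%N ->
    \sum_o (ce o * oapp x (x i) o ^+ r) *: oapp v w o = 0.
  move=> r rk; rewrite big_option /=; apply/colP=> j.
  have /matrixP/(_ (mxvec_index (Ordinal rk) j) 0) := Wc.
  rewrite !mxE mxvecE mxE /= summxE mulN1r mulNr => <-; apply/eqP.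
  rewrite addrC subr_eq0; apply/eqP/eq_bigr => l _.
  by rewrite block_vanderE mxE [RHS]mulrC mulrA.
rewrite big_option /= (bigD1 i) //= [X in _ + (_ + X)]big1 => [|j ji]; last first.
  by rewrite others_other // mulr0 scale0r.
rewrite addr0 mulN1r scaleNr addrC subr_eq0 mulrC -scalerA => /eqP.
by move/(can_inj (scalerK (others_self x_inj i)))->.
Qed.

Lemma pencil_det_factor :
  pencil_det A = \det (A ord_max) *: \prod_i ('X - (x i)%:P).
Proof.
have [sz_le top] := pencil_det_top A.
have nz_top : \det (A ord_max) != 0 by rewrite -unitfE -unitmxE.
have szp : size (pencil_det A) = (k * n).+1.
  by apply/eqP; rewrite eqn_leq sz_le ltnNge; apply/negP => /leq_sizeP/(_ _ (leqnn _))/eqP;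
    rewrite top (negPf nz_top).
have lead : lead_coef (pencil_det A) = \det (A ord_max) by rewrite /lead_coef szp.
rewrite -lead [LHS](@all_roots_prod_XsubC _ _ (codom x)).
- by rewrite big_image.
- by rewrite szp size_codom card_ord.
- apply/allP=> _ /codomP[i ->]; rewrite /root horner_pencil_det -det_tr.
  apply/det0P; exists (v i)^T; first by rewrite trmx_eq0.
  by rewrite -trmx_mul Av trmx0.
- by rewrite uniq_rootsE; apply/injectiveP.
Qed.
End EigenBasis.

(** * Solutions of the matrix equation *)

Lemma subrXX_telescope (R : pzRingType) (X Y : R) r :
  X ^+ r - Y ^+ r = \sum_(i < r) X ^+ i * (X - Y) * Y ^+ (r - i.+1).
Proof.
elim: r => [|r IH]; first by rewrite big_ord0 subrr.
rewrite big_ord_recr /= subnn mulr1 mulrBr -exprSr addrA.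
suffices -> : \sum_(i < r) X ^+ i * (X - Y) * Y ^+ (r.+1 - i.+1) = X ^+ r * Y - Y ^+ r.+1.
  by rewrite -[RHS]addrA [RHS]addrC [RHS]addrA addrNK.
rewrite exprSr -mulrBl IH mulr_suml; apply: eq_bigr => i _.
by rewrite subSS -(subnSK (ltn_ord i)) exprSr mulrA.
Qed.

(** Quotient of the division of the pencil by [x%:M - X] on the right; the remainder is the value of
    the matrix polynomial at [X]. *)
Definition pencil_quot (R : comNzRingType) k n (A : 'I_k.+1 -> 'M[R]_n) (X : 'M[R]_n) (x : R) :=
  \sum_(r < k.+1) \sum_(i < r) x ^+ i *: (A r *m X ^+ (r - i.+1)).

Lemma pencil_quotP (R : comNzRingType) k n (A : 'I_k.+1 -> 'M[R]_n) (X : 'M[R]_n) (x : R) :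
  pencil A x - mx_poly_eval A X = pencil_quot A X x *m (x%:M - X).
Proof.
rewrite /pencil -sumrB mulmx_suml; apply: eq_bigr => r _.
have -> : x ^+ r *: A r = A r *m (x%:M) ^+ r.
  elim: (nat_of_ord r) => [|m IH]; first by rewrite scale1r mulmx1.
  by rewrite [in RHS]exprSr -mulmxE mulmxA -IH mul_mx_scalar scalerA exprS.
rewrite -mulmxBr subrXX_telescope mulmx_sumr mulmx_suml; apply: eq_bigr => i _.
have commX m : (x%:M - X) *m X ^+ m = X ^+ m *m (x%:M - X).
  by apply/commrX/commr_sym/commrB => //; apply: comm_mx_scalar.
rewrite -mulmxE -mulmxA commX -[x%:M ^+ i]mul1mx.
have -> : (1%:M *m x%:M ^+ i : 'M_n) = (x ^+ i)%:M.
  rewrite mul1mx; elim: (nat_of_ord i) => [|m IH]; first by [].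
  by rewrite exprS IH exprS -mulmxE scalar_mxM.
by rewrite mul_scalar_mx -scalemxAr -scalemxAl mulmxA.
Qed.

Lemma map_mx_exp (R S : comNzRingType) (f : {rmorphism R -> S}) n (X : 'M[R]_n) r :
  map_mx f (X ^+ r) = map_mx f X ^+ r.
Proof.
elim: r => [|r IH]; first by rewrite !expr0 -[1]/(1%:M) map_scalar_mx rmorph1.
by rewrite !exprS -!mulmxE map_mxM IH.
Qed.

Lemma map_mx_poly_eval (R S : comNzRingType) (f : {rmorphism R -> S}) k n
    (A : 'I_k.+1 -> 'M[R]_n) (X : 'M[R]_n) :
  map_mx f (mx_poly_eval A X) = mx_poly_eval (fun r => map_mx f (A r)) (map_mx f X).
Proof.
rewrite /mx_poly_eval raddf_sum; apply: eq_bigr => r _.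
by rewrite /= map_mxM map_mx_exp.
Qed.

Lemma pencil_det_solution (R : comNzRingType) k n (A : 'I_k.+1 -> 'M[R]_n) (X : 'M[R]_n) :
    mx_solution A X ->
  pencil_det A = \det (pencil_quot (fun r => map_mx (@polyC R) (A r)) (map_mx (@polyC R) X) 'X)
      * char_poly X.
Proof.
move=> solX; rewrite /char_poly -det_mulmx -pencil_quotP -map_mx_poly_eval.
by rewrite [mx_poly_eval A X]solX map_mx0 subr0.
Qed.

Lemma horner_pencil_quot (R : comNzRingType) k n (A : 'I_k.+1 -> 'M[R]_n) (X : 'M[R]_n) x :
  (\det (pencil_quot (fun r => map_mx (@polyC R) (A r)) (map_mx (@polyC R) X) 'X)).[x]
   = \det (pencil_quot A X x).
Proof.
rewrite -[_.[x]]/(horner_eval x _) -det_map_mx; congr (\det _).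
have horK m p (B : 'M[R]_(m, p)) : map_mx (horner_eval x) (map_mx (@polyC R) B) = B.
  by apply/matrixP=> i j; rewrite !mxE /horner_eval hornerC.
rewrite raddf_sum; apply: eq_bigr => r _; rewrite raddf_sum; apply: eq_bigr => i _.
rewrite /= map_mxZ map_mxM map_mx_exp !horK; congr (_ *: _).
by rewrite rmorphXn /= /horner_eval hornerX.
Qed.

Lemma mulmx_expr_eigen (R : comNzRingType) n (X : 'M[R]_n) (w : 'cV_n) x r :
  X *m w = x *: w -> X ^+ r *m w = x ^+ r *: w.
Proof.
move=> Xw; elim: r => [|r IH]; first by rewrite mul1mx scale1r.
by rewrite exprSr -mulmxE -mulmxA Xw -scalemxAr IH scalerA -exprS.
Qed.

Lemma mx_poly_eval_eigen (R : comNzRingType) k n (A : 'I_k.+1 -> 'M[R]_n) (X : 'M[R]_n)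
    (w : 'cV_n) x :
  X *m w = x *: w -> mx_poly_eval A X *m w = pencil A x *m w.
Proof.
move=> Xw; rewrite !mulmx_suml; apply: eq_bigr => r _.
by rewrite -mulmxA (mulmx_expr_eigen _ Xw) -scalemxAr scalemxAl.
Qed.

Lemma col_mulmx (R : comNzRingType) m n p (B : 'M[R]_(m, n)) (C : 'M[R]_(n, p)) j :
  col j (B *m C) = B *m col j C.
Proof. by rewrite !colE mulmxA. Qed.

Lemma char_poly_trmx (R : comNzRingType) n (X : 'M[R]_n) : char_poly X^T = char_poly X.
Proof.
rewrite /char_poly -[RHS]det_tr; congr (\det _).
by rewrite /char_poly_mx linearB /= tr_scalar_mx map_trmx.
Qed.

Section Solutions.
Variables (F : fieldType) (k n : nat) (A : 'I_k.+1 -> 'M[F]_n).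
Variables (x : 'I_(k * n) -> F) (v : 'I_(k * n) -> 'cV[F]_n).
Hypotheses (k_gt0 : (0 < k)%N) (unitAk : A ord_max \in unitmx)
  (x_inj : injective x) (nz_v : forall i, v i != 0)
  (Av : forall i, pencil A (x i) *m v i = 0).
Hypothesis free_v : forall t : 'I_n -> 'I_(k * n), injective t ->
  (\matrix_(a, j) v (t j) a 0) \in unitmx.

Definition eigen_mx (t : 'I_n -> 'I_(k * n)) : 'M[F]_n := \matrix_(a, j) v (t j) a 0.

Definition eigen_sol (t : 'I_n -> 'I_(k * n)) : 'M[F]_n :=
  eigen_mx t *m diag_mx (\row_j x (t j)) *m invmx (eigen_mx t).

Lemma col_eigen_mx t j : col j (eigen_mx t) = v (t j).
Proof. by apply/colP=> a; rewrite !mxE. Qed.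

Lemma eigen_solP t X : injective t ->
  reflect (forall j, X *m v (t j) = x (t j) *: v (t j)) (X == eigen_sol t).
Proof.
move=> t_inj; have unitV : eigen_mx t \in unitmx := free_v t_inj.
have colD j : col j (eigen_mx t *m diag_mx (\row_j x (t j))) = x (t j) *: v (t j).
  by apply/colP=> a; rewrite mul_mx_diag !mxE mulrC.
apply: (iffP eqP) => [-> j | Xv].
  by rewrite -colD -col_eigen_mx -!col_mulmx mulmxKV.
rewrite /eigen_sol; apply: (can_inj (mulmxK unitV)); rewrite mulmxKV //.
apply/matrixP=> a j; have /colP/(_ a) := Xv j.
by rewrite -colD -col_eigen_mx -col_mulmx !mxE.
Qed.

Lemma eigen_sol_eigen t j : injective t ->
  eigen_sol t *m v (t j) = x (t j) *: v (t j).
Proof. by move=> t_inj; apply/eigen_solP. Qed.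

Lemma eigen_sol_solution t : injective t -> mx_solution A (eigen_sol t).
Proof.
move=> t_inj; have unitV : eigen_mx t \in unitmx := free_v t_inj.
apply: (can_inj (mulmxK unitV)); rewrite mul0mx; apply/matrixP=> a j.
have /colP/(_ a) := Av (t j).
by rewrite -(mx_poly_eval_eigen _ (eigen_sol_eigen j t_inj)) -col_eigen_mx -col_mulmx !mxE.
Qed.

Lemma eigen_sol_spec t (w : 'cV[F]_n) y : injective t -> w != 0 ->
  eigen_sol t *m w = y *: w -> exists j, y = x (t j).
Proof.
move=> t_inj nz_w Xw; have unitV : eigen_mx t \in unitmx := free_v t_inj.
pose u := invmx (eigen_mx t) *m w.
have Dw : w = eigen_mx t *m u by rewrite mulKVmx.
have Du : diag_mx (\row_j x (t j)) *m u = y *: u.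
  apply: (can_inj (mulKmx unitV)); rewrite -scalemxAr -Dw -Xw /eigen_sol.
  by rewrite -!mulmxA.
clearbody u.
have /existsP[j nz_uj] : [exists j, u j 0 != 0].
  apply: contraNT nz_w; rewrite negb_exists => /forallP u0.
  rewrite Dw (_ : u = 0) ?mulmx0 //; apply/colP=> j; rewrite [RHS]mxE.
  by apply/eqP; have := u0 j; rewrite negbK.
by exists j; have /colP/(_ j) := Du; rewrite mul_diag_mx !mxE => /(mulIf nz_uj).
Qed.

Lemma eigen_sol_codom t t' : injective t -> injective t' ->
  eigen_sol t = eigen_sol t' -> codom t =i codom t'.
Proof.
have sub s s' : injective s -> injective s' -> eigen_sol s = eigen_sol s' ->
    {subset codom s <= codom s'}.
  move=> s_inj s'_inj eq_ss' _ /codomP[j ->].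
  have := eigen_sol_eigen j s_inj; rewrite eq_ss'.
  by case/(eigen_sol_spec s'_inj (nz_v _)) => j' /x_inj->; apply: codom_f.
by move=> t_inj t'_inj eq_tt' i; apply/idP/idP; apply: sub.
Qed.

(** The characteristic polynomial of [X] divides det P, whose roots are distinct, so [X] has n
    distinct eigenvalues [x (t j)]. Each eigenvector lies in the kernel of the pencil at its
    eigenvalue, which is the line of [v (t j)]. *)
Lemma solution_eigen_sol X : mx_solution A X ->
  exists2 t, injective t & X = eigen_sol t.
Proof.
move=> solX; have Dp := pencil_det_solution solX.
have: char_poly X %| \prod_(i <- enum 'I_(k * n)) ('X - (x i)%:P).
  rewrite big_enum /= -(@dvdpZr _ (\det (A ord_max))) -?unitfE //.
  by rewrite -(pencil_det_factor unitAk x_inj nz_v Av) Dp dvdp_mull.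
case/dvdp_prod_XsubC => m; set s := mask m _ => eq_chi.
have Dchi : char_poly X = \prod_(i <- s) ('X - (x i)%:P).
  by apply/eqP; rewrite -eqp_monic ?char_poly_monic ?monic_prod_XsubC.
have szs : size s == n.
  by rewrite -eqSS -(size_prod_XsubC s x) -Dchi size_char_poly.
have uniq_s : uniq s by rewrite mask_uniq ?enum_uniq.
pose t j := tnth (Tuple szs) j.
have t_inj : injective t.
  exact/(tuple_uniqP (Tuple szs)).
exists t => //; apply/eqP/eigen_solP => // j.
have root_j : root (char_poly X) (x (t j)).
  rewrite Dchi -(big_map x xpredT (fun y => 'X - y%:P)) root_prod_XsubC map_f //.
  exact: mem_tnth.
have [w nz_w Xw] : exists2 w : 'cV_n, w != 0 & X *m w = x (t j) *: w.
  have: eigenvalue X^T (x (t j)) by rewrite eigenvalue_root_char char_poly_trmx.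
  case/eigenvalueP=> w Xw nz_w; exists w^T; first by rewrite trmx_eq0.
  by apply: trmx_inj; rewrite trmx_mul trmxK Xw linearZ /= trmxK.
have Aw : pencil A (x (t j)) *m w = 0.
  by rewrite -(mx_poly_eval_eigen _ Xw) [mx_poly_eval A X]solX mul0mx.
have [b Dw] := eigen_line unitAk x_inj nz_v Av Aw.
have nz_b : b != 0 by apply: contraNneq nz_w => b0; rewrite Dw b0 scale0r.
apply: (can_inj (scalerK nz_b)); rewrite scalemxAr -Dw Xw Dw.
by rewrite !scalerA mulrC.
Qed.

Definition draw_of (i0 : 'I_(k * n)) (S : {set 'I_(k * n)}) (j : 'I_n) := nth i0 (enum S) j.

Lemma draw_of_inj i0 (S : {set 'I_(k * n)}) : #|S| = n -> injective (draw_of i0 S).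
Proof.
move=> cardS i j /eqP; rewrite /draw_of nth_uniq ?enum_uniq // -?cardE ?cardS //.
by move/eqP/val_inj.
Qed.

Lemma codom_draw_of i0 (S : {set 'I_(k * n)}) : #|S| = n -> codom (draw_of i0 S) =i S.
Proof.
move=> cardS i; apply/codomP/idP => [[j ->]|Si].
  by rewrite -mem_enum mem_nth // -cardE cardS.
have lti : (index i (enum S) < n)%N.
  by apply: leq_trans (eq_leq cardS); rewrite cardE index_mem mem_enum.
by exists (Ordinal lti); rewrite /draw_of nth_index ?mem_enum.
Qed.

Lemma count_solutions : (0 < n)%N ->
  exists2 s, finite_solutions A s & size s = 'C(k * n, n).
Proof.
move=> n_gt0; have kn_gt0 : (0 < k * n)%N by rewrite muln_gt0 k_gt0.
pose i0 := Ordinal kn_gt0.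
pose draws := [set S : {set 'I_(k * n)} | #|S| == n].
have drawsP S : S \in enum draws -> #|S| = n by rewrite mem_enum inE => /eqP.
exists [seq eigen_sol (draw_of i0 D) | D <- enum draws]; last first.
  by rewrite size_map -cardE card_draws card_ord.
split=> [|X].
  rewrite map_inj_in_uniq ?enum_uniq // => S S' /drawsP cS /drawsP cS' eqSS'.
  apply/setP=> i; rewrite -(codom_draw_of i0 cS) -(codom_draw_of i0 cS').
  by apply: eigen_sol_codom eqSS' i; apply: draw_of_inj.
split=> [/solution_eigen_sol[t t_inj ->] | /mapP[S /drawsP cS ->]]; last first.
  exact/eigen_sol_solution/draw_of_inj.
pose S := [set i in codom t].
have cS : #|S| = n by rewrite cardsE card_codom // card_ord.
apply/mapP; exists S; first by rewrite mem_enum inE cS.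
apply/eqP/eigen_solP => [|j]; first exact: draw_of_inj.
have : draw_of i0 S j \in codom t.
  by have := codom_f (draw_of i0 S) j; rewrite codom_draw_of // inE.
by case/codomP=> l ->; apply: eigen_sol_eigen.
Qed.

Lemma trace_eigen_sol t : injective t -> \tr (eigen_sol t) = \sum_j x (t j).
Proof.
move=> t_inj; rewrite /eigen_sol mxtrace_mulC mulmxA mulVmx ?mul1mx ?mxtrace_diag; last first.
  exact: free_v.
by apply: eq_bigr => j _; rewrite mxE.
Qed.

(** det P is this determinant, as a polynomial, times the characteristic polynomial; two factors of
    a separable polynomial share no root. *)
Lemma eigen_sol_quot t j : injective t ->
  \det (pencil_quot A (eigen_sol t) (x (t j))) != 0.
Proof.
move=> t_inj; have solX := eigen_sol_solution t_inj.
set X := eigen_sol t in solX *.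
have Dp := pencil_det_solution solX.
rewrite -horner_pencil_quot; set Q := \det _ in Dp *.
have chi0 : root (char_poly X) (x (t j)).
  rewrite -char_poly_trmx -eigenvalue_root_char; apply/eigenvalueP.
  exists (v (t j))^T; last by rewrite trmx_eq0.
  by rewrite -trmx_mul eigen_sol_eigen // linearZ.
have: separable_poly (pencil_det A).
  rewrite (pencil_det_factor unitAk x_inj nz_v Av) separable_linear_factors //.
  by rewrite -unitfE -unitmxE.
rewrite Dp separable_mul => /and3P[_ _].
by rewrite coprimep_sym => /coprimep_root; apply.
Qed.
End Solutions.

(** * Multiplicities *)

(** Divided difference of the matrix polynomial, linear in [H]; for [Y = X] it is the derivative at
    [X] in the direction [H]. *)
Definition mx_slope (R : comNzRingType) k n (A : 'I_k.+1 -> 'M[R]_n) (X Y H : 'M[R]_n) :=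
  \sum_(r < k.+1) \sum_(i < r) A r *m X ^+ i *m H *m Y ^+ (r - i.+1).

Lemma mx_slopeP (R : comNzRingType) k n (A : 'I_k.+1 -> 'M[R]_n) (X Y : 'M[R]_n) :
  mx_poly_eval A X - mx_poly_eval A Y = mx_slope A X Y (X - Y).
Proof.
rewrite -sumrB; apply: eq_bigr => r _; rewrite -mulmxBr subrXX_telescope mulmx_sumr.
by apply: eq_bigr => i _; rewrite -!mulmxE !mulmxA.
Qed.

Definition slope_mx (R : comNzRingType) k n (A : 'I_k.+1 -> 'M[R]_n) (X Y : 'M[R]_n) :
    'M[R]_(n * n) :=
  \sum_(r < k.+1) \sum_(i < r) lin_mulmx (A r *m X ^+ i) *m lin_mulmxr (Y ^+ (r - i.+1)).

Lemma slope_mxP (R : comNzRingType) k n (A : 'I_k.+1 -> 'M[R]_n) (X Y H : 'M[R]_n) :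
  mxvec H *m slope_mx A X Y = mxvec (mx_slope A X Y H).
Proof.
rewrite /slope_mx mulmx_sumr linear_sum; apply: eq_bigr => r _.
rewrite mulmx_sumr linear_sum; apply: eq_bigr => i _.
by rewrite mulmxA !mul_vec_lin.
Qed.

Lemma map_slope_mx (R S : comNzRingType) (f : {rmorphism R -> S}) k n
    (A : 'I_k.+1 -> 'M[R]_n) (X Y : 'M[R]_n) :
  map_mx f (slope_mx A X Y) =
  slope_mx (fun r => map_mx f (A r)) (map_mx f X) (map_mx f Y).
Proof.
apply/row_matrixP=> a; rewrite -map_row !rowE.
pose H : 'M[R]_n := vec_mx (delta_mx 0 a).
have -> : delta_mx 0 a = mxvec H by rewrite vec_mxK.
have -> : delta_mx 0 a = mxvec (map_mx f H) :> 'rV_(n * n).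
  by rewrite -map_mxvec vec_mxK map_delta_mx.
rewrite !slope_mxP map_mxvec; congr mxvec; rewrite raddf_sum; apply: eq_bigr => r _ /=.
rewrite raddf_sum; apply: eq_bigr => i _ /=.
by rewrite !map_mxM !map_mx_exp.
Qed.

Section MpolyIdeal.
Variables (F : fieldType) (N : nat).

(** The class [C] contains constants and variables and is closed under sums and products, so it
    contains every polynomial. *)
Lemma mpoly_sub_eval (v : 'I_N -> F) (p : {mpoly F[N]}) :
  exists h : 'I_N -> {mpoly F[N]}, p - (p.@[v])%:MP = \sum_l ('X_l - (v l)%:MP) * h l.
Proof.
pose C (q : {mpoly F[N]}) := exists h : 'I_N -> {mpoly F[N]},
  q - (q.@[v])%:MP = \sum_l ('X_l - (v l)%:MP) * h l.
have CC c : C c%:MP.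
  by exists (fun _ => 0); rewrite mevalC subrr big1 // => l _; rewrite mulr0.
have CX l : C 'X_l.
  exists (fun m => (m == l)%:R); rewrite mevalXU (bigD1 l) //= eqxx mulr1 big1 ?addr0 //.
  by move=> m /negPf ml; rewrite ml mulr0.
have CD q r : C q -> C r -> C (q + r).
  move=> [h Dq] [g Dr]; exists (fun l => h l + g l).
  rewrite mevalD mpolyCD opprD addrACA Dq Dr -big_split.
  by apply: eq_bigr => l _; rewrite mulrDr.
have CM q r : C q -> C r -> C (q * r).
  move=> [h Dq] [g Dr]; exists (fun l => h l * r + (q.@[v])%:MP * g l).
  rewrite mevalM mpolyCM.
  have -> : q * r - (q.@[v])%:MP * (r.@[v])%:MP
     = (q - (q.@[v])%:MP) * r + (q.@[v])%:MP * (r - (r.@[v])%:MP).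
    by rewrite mulrBl mulrBr addrA addrNK.
  rewrite Dq Dr mulr_suml mulr_sumr -big_split; apply: eq_bigr => l _ /=.
  by rewrite mulrDr; congr (_ + _); [rewrite mulrA | rewrite mulrCA].
suffices: C (\sum_(m <- msupp p) p@_m *: 'X_[m]) by rewrite -mpolyE.
elim/big_rec: _ => [|m q _ Cq]; first by rewrite -mpolyC0.
apply: CD => //; rewrite -mul_mpolyC; apply: (CM) => //.
rewrite (mpolyXE _ 1); elim/big_rec: _ => [|l r _ Cr]; first exact: CC 1.
apply: (CM) => //; elim: (m _) => [|e IH]; first exact: (CC 1).
by rewrite exprS; apply: (CM).
Qed.
End MpolyIdeal.

Section SimpleZero.
Variables (F : fieldType) (N : nat) (I : finType) (f : I -> {mpoly F[N]}).
Variables (v : 'rV[F]_N) (g : {mpoly F[N]}) (h : 'I_N -> I -> {mpoly F[N]}).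
Hypotheses (f_v : zero_of f v) (g_v : g.@[v 0] != 0)
  (gX : forall l, g * ('X_l - (v 0 l)%:MP) = \sum_t h l t * f t).

(** By [gX], and since [g] is a unit at [v], the local ideal contains every [X_l - v_l]: it is the
    maximal ideal, and the quotient is [F] with basis 1. The same [g] isolates [v], as a zero where
    [g] does not vanish has the coordinates of [v]. *)
Lemma simple_zero_of_slope : simple_zero f v.
Proof.
have nz_q q : q.@[v 0] != 0 -> q != 0.
  by apply: contraNneq => ->; rewrite meval0.
split.
  split=> //; exists g; split=> // w f_w g_w; apply/rowP=> l.
  have /(congr1 (meval (w 0))) := gX l; rewrite raddf_sum big1 => [/eqP|t _ /=]; last first.
    by rewrite mevalM f_w mulr0.
  rewrite mevalM mulf_eq0 (negPf g_w) mevalB mevalXU mevalC subr_eq0 => /eqP->.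
  by [].
have tofrac_nz q : q != 0 -> tofrac q != 0 :> {fraction {mpoly F[N]}}.
  by rewrite tofrac_eq0.
exists (fun _ => 1); split=> [_|r [p [q [qv ->]]]|c].
- by exists 1, 1; rewrite meval1 oner_neq0 divr1 tofrac1.
(* [c] is the value of [r] at [v]. The numerator [p1] of the difference vanishes at [v], so it is a
   combination of the [X_l - v_l]; expanding the fraction by [g] brings in the [f t]. *)
- pose c : F := p.@[v 0] / q.@[v 0]; exists (fun _ => c); rewrite big_ord1 mulr1.
  pose p1 := p - c%:MP * q.
  have p1v : p1.@[v 0] = 0 by rewrite mevalB mevalM mevalC divfK // subrr.
  have [u Du] := mpoly_sub_eval (v 0) p1; rewrite p1v mpolyC0 subr0 in Du.
  exists (fun t => tofrac (\sum_l h l t * u l) / tofrac (q * g)); split=> [t|].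
    by exists (\sum_l h l t * u l), (q * g); rewrite mevalM mulf_neq0.
  have [nzq nzg] := (tofrac_nz _ (nz_q _ qv), tofrac_nz _ (nz_q _ g_v)).
  have -> : tofrac p / tofrac q - tofrac c%:MP = tofrac (g * p1) / tofrac (q * g).
    rewrite !tofracM [tofrac g * _]mulrC -mulf_div divff // mulr1.
    by rewrite /p1 tofracB mulrBl tofracM (mulfK nzq).
  rewrite Du mulr_sumr; under eq_bigr => l _ do rewrite mulrA gX.
  rewrite [RHS](eq_bigr (fun t => tofrac ((\sum_l h l t * u l) * f t) / tofrac (q * g))); last first.
    by move=> t _; rewrite mulrAC -tofracM.
  rewrite -[RHS]mulr_suml -[in RHS]rmorph_sum; congr (tofrac _ / _).
  under [RHS]eq_bigr => t _ do rewrite mulr_suml.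
  rewrite exchange_big; apply: eq_bigr => l _; rewrite mulr_suml.
  by apply: eq_bigr => t _; rewrite mulrAC.
rewrite big_ord1 mulr1 => -[e [loc_e De]] i; rewrite ord1.
(* Elements of the local ideal are fractions whose numerator vanishes at [v], so a constant among
   them is 0. *)
suffices [p [q [qv pv Dc]]] : exists p q, [/\ q.@[v 0] != 0, p.@[v 0] = 0 &
    tofrac (c 0)%:MP = tofrac p / tofrac q].
  have nzq := tofrac_nz _ (nz_q _ qv).
  have /eqP : tofrac ((c 0)%:MP * q) = tofrac p by rewrite tofracM Dc divfK.
  rewrite tofrac_eq => /eqP/(congr1 (meval (v 0))); rewrite mevalM mevalC pv => /eqP.
  by rewrite mulf_eq0 (negPf qv) orbF => /eqP.
rewrite De; elim/big_rec: _ => [|t _ _ [p [q [qv pv ->]]]].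
  by exists 0, 1; rewrite meval1 meval0 oner_neq0 tofrac0 mul0r.
have [p' [q' [q'v ->]]] := loc_e t.
exists (p' * f t * q + p * q'), (q' * q); split.
- by rewrite mevalM mulf_neq0.
- by rewrite mevalD !mevalM f_v pv mulr0 !mul0r addr0.
rewrite mulrAC -tofracM addf_div ?tofrac_nz ?nz_q //.
by rewrite -!tofracM -tofracD.
Qed.
End SimpleZero.

(** For a matrix [Xg] of indeterminates, the value at [Xg] is the slope matrix [M] applied to
    [Xg - X'], since the value at [X'] is 0. The adjugate then puts [\det M] times each coordinate
    difference into the ideal of the equations. At [X], [M] becomes the Jacobian matrix, invertible
    by the regularity hypothesis. *)
Lemma simple_solution_regular (F : fieldType) k n (A : 'I_k.+1 -> 'M[F]_n) (X : 'M[F]_n) :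
    mx_solution A X -> (forall H, mx_slope A X X H = 0 -> H = 0) ->
  simple_solution A X.
Proof.
move=> solX regX.
pose A' r := map_mx (@mpolyC (n * n) F) (A r).
pose Xg : 'M[{mpoly F[n * n]}]_n := \matrix_(i, j) 'X_(mxvec_index i j).
pose X' := map_mx (@mpolyC (n * n) F) X.
pose M := slope_mx A' Xg X'.
pose ev (w : 'rV[F]_(n * n)) : {rmorphism {mpoly F[n * n]} -> F} := meval (w 0).
have evA w r : map_mx (ev w) (A' r) = A r.
  by apply/matrixP=> i j; rewrite !mxE /= mevalC.
have evXg w : map_mx (ev w) Xg = vec_mx w.
  by apply/matrixP=> i j; rewrite !mxE /= mevalXU.
have evX' w : map_mx (ev w) X' = X.
  by apply/matrixP=> i j; rewrite !mxE /= mevalC.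
have evS w : map_mx (ev w) (mx_poly_eval A' Xg) = mx_poly_eval A (vec_mx w).
  rewrite map_mx_poly_eval evXg; apply: eq_bigr => r _; congr (_ *m _); exact: evA.
have solX' : mx_poly_eval A' X' = 0.
  by rewrite -map_mx_poly_eval [mx_poly_eval A X]solX map_mx0.
apply: (@simple_zero_of_slope _ _ _ _ _ (\det M)
    (fun l t => (\adj M) (mxvec_index t.1 t.2) l)).
- move=> [i j]; have /matrixP/(_ i j) := evS (mxvec X).
  by rewrite mxvecK [mx_poly_eval A X]solX !mxE.
- rewrite -[_.@[_]]/(ev (mxvec X) _) -det_map_mx map_slope_mx evXg evX' mxvecK.
  rewrite -unitfE -unitmxE -row_free_unit; apply: inj_row_free => w.
  rewrite -[w]vec_mxK.
  have -> : slope_mx (fun r => map_mx (ev (mxvec X)) (A' r)) X X = slope_mx A X X.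
    by apply: eq_bigr => r _; apply: eq_bigr => i _; rewrite evA.
  rewrite slope_mxP => /(congr1 vec_mx); rewrite mxvecK linear0 => /regX->.
  by rewrite linear0.
move=> l; have := slope_mxP A' Xg X' (Xg - X').
rewrite -mx_slopeP solX' subr0 => /(congr1 (mulmx^~ (\adj M))).
rewrite -mulmxA mul_mx_adj mul_mx_scalar => /matrixP/(_ 0 l).
case/mxvec_indexP: l => i j; rewrite [LHS]mxE mxvecE [RHS]mxE => slopeE.
rewrite mxvecE in slopeE.
rewrite (_ : 'X__ - _ = (Xg - X') i j) ?slopeE; last by rewrite !mxE.
rewrite sum_mxvec_index pair_bigA; apply: eq_bigr => -[a b] _ /=.
by rewrite mxvecE mulrC.
Qed.

Section SimpleEigenSol.
Variables (F : fieldType) (k n : nat) (A : 'I_k.+1 -> 'M[F]_n).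
Variables (x : 'I_(k * n) -> F) (v : 'I_(k * n) -> 'cV[F]_n).
Hypotheses (unitAk : A ord_max \in unitmx)
  (x_inj : injective x) (nz_v : forall i, v i != 0)
  (Av : forall i, pencil A (x i) *m v i = 0).
Hypothesis free_v : forall t : 'I_n -> 'I_(k * n), injective t ->
  (\matrix_(a, j) v (t j) a 0) \in unitmx.

(** If the derivative kills [H], applying it to [v (t j)] turns the powers on the right of [H] into
    powers of the eigenvalue, so the pencil quotient at [x (t j)] kills [H *m v (t j)]. This
    quotient is invertible and the eigenvectors form a basis, whence [H = 0]. *)
Lemma eigen_sol_simple t : injective t -> simple_solution A (eigen_sol x v t).
Proof.
move=> t_inj; apply: simple_solution_regular => [|H slope0].
  exact: eigen_sol_solution.
have unitV := free_v t_inj; apply: (can_inj (mulmxK unitV)); rewrite mul0mx.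
apply/matrixP=> a j; pose u := H *m v (t j).
suffices /colP/(_ a) : u = 0.
  by rewrite /u -(col_eigen_mx v) -col_mulmx !mxE.
have := eigen_sol_quot unitAk x_inj nz_v Av free_v j t_inj.
rewrite -unitfE -unitmxE => unitQ; apply: (can_inj (mulKmx unitQ)); rewrite mulmx0.
have := congr1 (mulmx^~ (v (t j))) slope0; rewrite mul0mx => <-.
rewrite !mulmx_suml; apply: eq_bigr => r _; rewrite !mulmx_suml.
(* The scalar has exponent [i] in the quotient and [r - i.+1] in the slope, hence the reversal. *)
rewrite (reindex_inj rev_ord_inj); apply: eq_bigr => i _ /=.
rewrite subnSK // subKn ?(ltnW (ltn_ord i)) // -[RHS]mulmxA (mulmx_expr_eigen _ (eigen_sol_eigen x free_v j t_inj)).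
by rewrite -scalemxAr -scalemxAl /u mulmxA.
Qed.
End SimpleEigenSol.

(** * Interpolation of matrix polynomials *)

Lemma fraction_ratio (R : idomainType) (y : {fraction R}) : exists a b, y = tofrac a / tofrac b.
Proof.
elim/quotW: y => y; exists (\n_y), (\d_y).
have nd : tofrac \d_y != 0 :> {fraction R} by rewrite tofrac_eq0 denom_ratioP.
apply: (mulIf nd); rewrite divfK // -[LHS]/(FracField.mul _ _); unlock tofrac.
rewrite -FracField.pi_mul; apply/eqmodP => /=.
rewrite /FracField.equivf /FracField.mulf /= !numden_Ratio ?mulr1 ?oner_eq0 ?denom_ratioP //.
by rewrite mulrC.
Qed.

Lemma rmorph_mpolyE (R S : comNzRingType) n (f : {rmorphism {mpoly R[n]} -> S})
    (j : {rmorphism R -> S}) p :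
  (forall c, f c%:MP = j c) -> f p = mmap j (fun i => f 'X_i) p.
Proof.
move=> fC; rewrite {1}[p]mpolyE rmorph_sum; apply: eq_bigr => m _.
rewrite -mul_mpolyC rmorphM fC mpolyXE_id rmorph_prod; congr (_ * _).
by apply: eq_bigr => i _; rewrite rmorphXn.
Qed.

Lemma map_resultant_gen (aR rR : nzRingType) (f : {rmorphism aR -> rR}) (p q : {poly aR}) :
    f (lead_coef p) != 0 -> f (lead_coef q) != 0 ->
  f (resultant p q) = resultant (map_poly f p) (map_poly f q).
Proof.
move=> nz_fp nz_fq; rewrite /resultant /Sylvester_mx !size_map_poly_id0 //.
rewrite -det_map_mx /= map_col_mx; congr (\det (col_mx _ _));
  by apply: map_lin1_mx => v; rewrite map_poly_rV rmorphM /= map_rVpoly.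
Qed.

Section Interpolation.
Variables (R : comNzRingType) (k n : nat).
Variables (x : 'I_(k * n) -> R) (v : 'I_(k * n) -> 'cV[R]_n) (C : 'M[R]_n).

(* The matrix polynomial with leading coefficient C whose eigenpairs are the
   (x i, v i), multiplied by the square of the determinant of the block
   Vandermonde matrix: a factor to clear the denominators, and another one for
   the result not to depend on the order of the pairs. *)
Definition interp_mx (r : 'I_k.+1) : 'M[R]_n :=
  let W := block_vander k x v in
  let E := C *m (\matrix_(a, i) (x i ^+ k * v i a 0)) *m \adj W in
  oapp (fun r' : 'I_k => \matrix_(a, j) - (\det W * E a (mxvec_index r' j)))
    (\det W ^+ 2 *: C) (insub (val r)).

Lemma interp_mx_top : interp_mx ord_max = \det (block_vander k x v) ^+ 2 *: C.
Proof. by rewrite /interp_mx insubF //= ltnn. Qed.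

(** By the adjugate identity [\adj W *m W = (\det W)%:M], the lower terms add up to minus the top
    term. *)
Lemma interp_mx_eigen i : pencil interp_mx (x i) *m v i = 0.
Proof.
rewrite mulmx_suml big_ord_recr /= interp_mx_top; set W := block_vander k x v.
pose U : 'M[R]_(n, k * n) := \matrix_(a, i) (x i ^+ k * v i a 0).
apply/colP=> a; rewrite mxE [RHS]mxE; apply/eqP; rewrite addr_eq0; apply/eqP.
have -> : ((x i ^+ k *: (\det W ^+ 2 *: C)) *m v i) a 0
    = \det W * (C *m U *m \adj W *m W) a i.
  rewrite -!mulmxA mul_adj_mx mulmxA mul_mx_scalar [in RHS]mxE mulrA -expr2.
  rewrite scalerA mulrC -scalerA -!scalemxAl mxE; congr (_ * _).
  rewrite mxE !mxE mulr_sumr; apply: eq_bigr => b _.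
  by rewrite !mxE mulrCA.
rewrite summxE [in RHS]mxE sum_mxvec_index mulr_sumr -sumrN; apply: eq_bigr => r _.
rewrite -scalemxAl mxE mxE !mulr_sumr -sumrN; apply: eq_bigr => j _.
rewrite block_vanderE /interp_mx insubT /= => [|lt_r]; last first.
  rewrite mxE (_ : Sub _ _ = r) ?mulNr ?mulrN; last exact: val_inj.
  by rewrite !mulrA; congr (- (_ * _)); rewrite -mulrA mulrC.
exact: ltn_ord.
Qed.
End Interpolation.

Lemma map_interp_mx (R S : comNzRingType) (f : {rmorphism R -> S}) k n
    (x : 'I_(k * n) -> R) (v : 'I_(k * n) -> 'cV[R]_n) (C : 'M[R]_n) r :
  map_mx f (interp_mx x v C r) =
  interp_mx (fun i => f (x i)) (fun i => map_mx f (v i)) (map_mx f C) r.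
Proof.
rewrite /interp_mx -map_block_vander -map_mx_adj det_map_mx.
case: insubP => [r' _ _|_] /=; last by rewrite map_mxZ rmorphXn.
apply/matrixP=> a j; rewrite !mxE rmorphN rmorphM; congr (- (_ * _)).
rewrite rmorph_sum; apply: eq_bigr => b _; rewrite rmorphM !mxE; congr (_ * _).
by rewrite rmorph_sum; apply: eq_bigr => l _; rewrite !mxE !rmorphM rmorphXn.
Qed.

(** Both families satisfy the same eigenpair equations, and they share the leading coefficient
    because permuting columns changes the determinant by a sign, which the square absorbs;
    uniqueness concludes. *)
Lemma interp_mx_perm (R : comUnitRingType) k n (x : 'I_(k * n) -> R)
    (v : 'I_(k * n) -> 'cV[R]_n) (C : 'M[R]_n) (t : 'S_(k * n)) r :
    block_vander k x v \in unitmx ->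
  interp_mx (fun i => x (t i)) (fun i => v (t i)) C r = interp_mx x v C r.
Proof.
move=> unitW; apply: (pencil_uniq unitW) r => [i|i|].
- have := interp_mx_eigen (fun i => x (t i)) (fun i => v (t i)) C (t^-1%g i).
  by rewrite permKV.
- exact: interp_mx_eigen.
rewrite !interp_mx_top; congr (_ *: _).
have -> : block_vander k (fun i => x (t i)) (fun i => v (t i)) = col_perm t (block_vander k x v).
  by apply/matrixP=> a i; case/mxvec_indexP: a => s j; rewrite [RHS]mxE !block_vanderE.
by rewrite col_permE det_mulmx det_perm exprMn -signr_odd sqrr_sign mulr1.
Qed.

Lemma interp_mx_uniq (F : fieldType) k n (x : 'I_(k * n) -> F)
    (v : 'I_(k * n) -> 'cV[F]_n) (A : 'I_k.+1 -> 'M[F]_n) r :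
    block_vander k x v \in unitmx -> (forall i, pencil A (x i) *m v i = 0) ->
  interp_mx x v ((\det (block_vander k x v) ^+ 2)^-1 *: A ord_max) r = A r.
Proof.
move=> unitW Av; apply: (pencil_uniq unitW) => // [i|]; first exact: interp_mx_eigen.
have nz_det : \det (block_vander k x v) != 0 by rewrite -unitfE -unitmxE.
by rewrite interp_mx_top scalerA divff ?scale1r // expf_neq0.
Qed.

(** * The generic pencil *)

(** Built from a diagonal pencil whose entries [p j] have disjoint sets of k roots, so that the
    eigenvectors are unit vectors. It will show that the block Vandermonde determinant of
    indeterminates is not zero. *)
Lemma exists_block_vander k n : exists (x : 'I_(k * n) -> rat) (v : 'I_(k * n) -> 'cV[rat]_n),
  \det (block_vander k x v) != 0.
Proof.
pose x (i : 'I_(k * n)) : rat := i%:R.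
pose part (i : 'I_(k * n)) : 'I_n := mxvec (\matrix_(r < k, j < n) j) 0 i.
pose v i : 'cV[rat]_n := delta_mx (part i) 0.
pose p (j : 'I_n) := \prod_(r < k) ('X - (x (mxvec_index r j))%:P).
pose A (r : 'I_k.+1) : 'M[rat]_n := diag_mx (\row_j (p j)`_r).
exists x, v; rewrite -unitfE -unitmxE.
have szp j : size (p j) = k.+1 by rewrite size_prod_XsubC /index_enum -enumT size_enum_ord.
apply: (@block_vander_unit _ _ _ A).
- rewrite /A unitmxE unitfE det_diag; apply/prodf_neq0 => j _; rewrite mxE.
  rewrite (_ : _`_ _ = lead_coef (p j)); last by rewrite /lead_coef szp.
  by rewrite lead_coef_eq0 -size_poly_gt0 szp.
- by move=> i j /eqP; rewrite /x Num.Theory.eqr_nat => /eqP/val_inj.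
- move=> i; apply/eqP=> /matrixP/(_ (part i) 0); rewrite !mxE !eqxx => /eqP.
  by rewrite oner_eq0.
move=> i; have -> : pencil A (x i) = diag_mx (\row_j (p j).[x i]).
  rewrite /pencil /A; apply/matrixP=> a b; rewrite summxE !mxE horner_coef szp.
  rewrite -sumrMnl; apply: eq_bigr => r _.
  by rewrite !mxE mulrnAr mulrC.
apply/colP=> a; rewrite mul_diag_mx !mxE eqxx andbT.
have [->|] := eqVneq; last by rewrite mulr0.
case/mxvec_indexP: i => r j; rewrite /part mxvecE mxE horner_prod (bigD1 r) //=.
by rewrite !hornerE subrr !mul0r.
Qed.

Section GenericPoint.
Variables (k n : nat).
Local Notation d := (k * n)%N.
Definition pair_var : finType := ('I_d + 'I_d * 'I_n + 'I_n * 'I_n)%type.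
Definition coef_var : finType := ('I_k.+1 * 'I_n * 'I_n)%type.

Definition gen_var (T : finType) (t : T) : {mpoly rat[#|T|]} := 'X_(enum_rank t).

Definition gen_eval (T : finType) (S : comUnitRingType) (phi : {rmorphism rat -> S}) (a : T -> S) :
  {rmorphism {mpoly rat[#|T|]} -> S} := mmap phi (fun i => a (enum_val i)).

Lemma gen_eval_var (T : finType) (S : comUnitRingType) (phi : {rmorphism rat -> S}) (a : T -> S) t :
  gen_eval phi a (gen_var t) = a t.
Proof. by rewrite /= mmapX mmap1U enum_rankK. Qed.

Lemma gen_eval_const (T : finType) (S : comUnitRingType) (phi : {rmorphism rat -> S}) (a : T -> S) c :
  gen_eval phi a c%:MP = phi c.
Proof. by rewrite /= mmapC. Qed.

(** Agreement on constants is automatic, morphisms from the rationals being unique. *)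
Lemma gen_eval_ext (T : finType) (S : comUnitRingType) (f g : {rmorphism {mpoly rat[#|T|]} -> S}) :
  (forall t, f (gen_var t) = g (gen_var t)) -> f =1 g.
Proof.
move=> eq_fg p.
have fC c : f c%:MP = (f \o @mpolyC #|T| rat) c by [].
have var_C c : g c%:MP = (f \o @mpolyC #|T| rat) c.
  rewrite -[LHS]/((g \o @mpolyC #|T| rat) c).
  by rewrite (fmorph_eq_rat (g \o @mpolyC #|T| rat)) (fmorph_eq_rat (f \o @mpolyC #|T| rat)).
rewrite (rmorph_mpolyE p fC) (rmorph_mpolyE p var_C); apply: eq_bigr => m _.
congr (_ * _); apply: eq_bigr => i _.
by have := eq_fg (enum_val i); rewrite /gen_var enum_valK => ->.
Qed.

Definition var_x (i : 'I_d) := gen_var (inl (inl i) : pair_var).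
Definition var_v (i : 'I_d) : 'cV_n := \col_j gen_var (inl (inr (i, j)) : pair_var).
Definition var_C : 'M_n := \matrix_(a, b) gen_var (inr (a, b) : pair_var).

Definition pair_point (S : comUnitRingType) (x : 'I_d -> S) (v : 'I_d -> 'cV[S]_n)
    (C : 'M[S]_n) (t : pair_var) : S :=
  match t with
  | inl (inl i) => x i
  | inl (inr ij) => v ij.1 ij.2 0
  | inr ab => C ab.1 ab.2
  end.

Section PairEval.
Variables (S : comUnitRingType) (phi : {rmorphism rat -> S}).
Variables (x : 'I_d -> S) (v : 'I_d -> 'cV[S]_n) (C : 'M[S]_n).
Definition pair_ev := gen_eval phi (pair_point x v C).

Lemma pair_ev_x i : pair_ev (var_x i) = x i.
Proof. by rewrite /pair_ev gen_eval_var. Qed.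
Lemma pair_ev_v i : map_mx pair_ev (var_v i) = v i.
Proof. by apply/colP=> j; rewrite !mxE /pair_ev gen_eval_var. Qed.
Lemma pair_ev_C : map_mx pair_ev var_C = C.
Proof. by apply/matrixP=> a b; rewrite !mxE /pair_ev gen_eval_var. Qed.
Lemma pair_ev_interp r : map_mx pair_ev (interp_mx var_x var_v var_C r) = interp_mx x v C r.
Proof.
rewrite map_interp_mx pair_ev_C.
have -> : (fun i => pair_ev (var_x i)) = x by apply: functional_extensionality; apply: pair_ev_x.
by have -> : (fun i => map_mx pair_ev (var_v i)) = v by apply: functional_extensionality; apply: pair_ev_v.
Qed.
End PairEval.
End GenericPoint.

(** The resultant of [p] and its derivative is nonzero because its image under [f] is, and the
    injective [u] keeps it nonzero: separability passes from one specialization to a generic one. *)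
Lemma separable_specialize (R : idomainType) (E F : fieldType) (f : {rmorphism R -> E})
    (u : {rmorphism R -> F}) (p : {poly R}) m :
    [pchar E] =i pred0 -> injective u -> (0 < m)%N -> (size p <= m.+1)%N -> f p`_m != 0 ->
  separable_poly (map_poly f p) -> separable_poly (map_poly u p).
Proof.
move=> ch0 inju m_gt0 szp fpm.
have leadE (q : {poly R}) l : (size q <= l.+1)%N -> f q`_l != 0 -> lead_coef q = q`_l.
  move=> szq fql; rewrite /lead_coef.
  suffices -> : size q = l.+1 by [].
  apply/eqP; rewrite eqn_leq szq ltnNge; apply: contraNN fql => /leq_sizeP/(_ _ (leqnn _))->.
  by rewrite rmorph0.
have nzp : p != 0 by apply: contraNneq fpm => ->; rewrite coef0 rmorph0.
(* Characteristic 0 keeps the leading coefficient of the derivative nonzero under [f], so that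
   forming the resultant commutes with [f]. *)
have fdm : f (p^`())`_m.-1 != 0.
  rewrite coef_deriv prednK // rmorphMn -mulr_natr mulf_neq0 //.
  by move/pcharf0P: ch0 => ->; rewrite -lt0n.
have szd : (size p^`() <= m.-1.+1)%N.
  by rewrite prednK // -ltnS; apply: leq_trans (lt_size_deriv nzp) szp.
rewrite !separable_poly.unlock !deriv_map => cop.
have rho_nz : resultant p p^`() != 0.
  apply: contraTneq cop => rho0; rewrite /coprimep.
  have := map_resultant_gen (f := f) (p := p) (q := p^`()).
  rewrite (leadE _ _ szp fpm) (leadE _ _ szd fdm) => /(_ fpm fdm).
  rewrite rho0 rmorph0 => /esym/eqP; rewrite resultant_eq0.
  by case: eqP => // ->.
have unz a : a != 0 -> u a != 0 by rewrite -(inj_eq inju) rmorph0.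
have nzd : p^`() != 0 by apply: contraNneq fdm => ->; rewrite coef0 rmorph0.
move/unz: rho_nz; rewrite map_resultant_gen ?unz ?lead_coef_eq0 // resultant_eq0 -leqNgt.
rewrite /coprimep => le1; rewrite eqn_leq le1 size_poly_gt0 gcdp_eq0 negb_and.
by rewrite -lead_coef_eq0 lead_coef_map_eq ?unz ?lead_coef_eq0.
Qed.

Lemma closed_eigenpairs (F : closedFieldType) k n (B : 'I_k.+1 -> 'M[F]_n) :
    B ord_max \in unitmx -> separable_poly (pencil_det B) ->
  exists (x : 'I_(k * n) -> F) (v : 'I_(k * n) -> 'cV[F]_n),
    [/\ injective x, forall i, v i != 0 & forall i, pencil B (x i) *m v i = 0].
Proof.
move=> unitB sepB; have [szB topB] := pencil_det_top B.
have nz_top : (pencil_det B)`_(k * n) != 0 by rewrite topB -unitfE -unitmxE.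
have szp : size (pencil_det B) = (k * n).+1.
  apply/eqP; rewrite eqn_leq szB ltnNge; apply: contraNN nz_top.
  by move=> /leq_sizeP/(_ _ (leqnn _))->.
have [r Dr] := closed_field_poly_normal (pencil_det B).
have nzl : lead_coef (pencil_det B) != 0 by rewrite lead_coef_eq0 -size_poly_gt0 szp.
have szr : size r = (k * n)%N.
  by apply: succn_inj; rewrite -szp Dr size_scale // size_prod_XsubC.
have uniq_r : uniq r.
  move: sepB; rewrite Dr -mul_polyC separable_mul => /and3P[_ + _].
  by rewrite separable_prod_XsubC.
have root_r (i : 'I_(k * n)) : root (pencil_det B) r`_i.
  by rewrite Dr rootZ // root_prod_XsubC mem_nth ?szr.
have det_r (i : 'I_(k * n)) : \det (pencil B r`_i) = 0.
  by rewrite -horner_pencil_det; apply/rootP.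
exists (fun i => r`_i), (fun i => sval (pencil_ker (det_r i))); split.
- by move=> i j /eqP; rewrite nth_uniq ?szr // => /eqP/val_inj.
- by move=> i; have /andP[] := svalP (pencil_ker (det_r i)).
- by move=> i; have /andP[_ /eqP] := svalP (pencil_ker (det_r i)).
Qed.

Section GenericModel.
Variables (k n : nat) (k_gt0 : (0 < k)%N) (n_gt0 : (0 < n)%N).
Local Notation d := (k * n)%N.
Local Notation P := {mpoly rat[#|pair_var k n|]}.
Local Notation M := {fraction P}.
Local Notation frac := (@tofrac P).

Definition frac_rat : {rmorphism rat -> M} := frac \o (@mpolyC #|pair_var k n| rat).

Lemma frac_pchar0 : [pchar M] =i pred0.
Proof. by move=> p; rewrite (fmorph_pchar frac_rat) Num.Theory.pchar_num. Qed.

Definition frac_x (i : 'I_d) : M := frac (var_x i).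
Definition frac_v (i : 'I_d) : 'cV[M]_n := map_mx frac (var_v i).
Definition frac_C : 'M[M]_n := map_mx frac (var_C k n).
Definition frac_A : 'I_k.+1 -> 'M[M]_n := interp_mx frac_x frac_v frac_C.

Lemma frac_neq0 (p : P) (f : {rmorphism P -> rat}) : f p != 0 -> frac p != 0.
Proof. by rewrite tofrac_eq0; apply: contraNneq => ->; rewrite rmorph0. Qed.

Lemma map_pair_ev_vander (S : comUnitRingType) (phi : {rmorphism rat -> S}) x v C :
  map_mx (pair_ev phi x v C) (block_vander k (@var_x k n) (@var_v k n)) = block_vander k x v.
Proof.
rewrite map_block_vander; congr block_vander; apply: functional_extensionality => i.
  exact: pair_ev_x.
exact: pair_ev_v.
Qed.

Lemma frac_vander_unit : block_vander k frac_x frac_v \in unitmx.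
Proof.
rewrite unitmxE unitfE -map_block_vander det_map_mx.
have [x [v nz]] := exists_block_vander k n.
by apply: (@frac_neq0 _ (pair_ev idfun x v 0)); rewrite -det_map_mx map_pair_ev_vander.
Qed.

Lemma frac_A_unit : frac_A ord_max \in unitmx.
Proof.
rewrite /frac_A interp_mx_top unitmxE detZ unitfE mulf_neq0 ?expf_neq0 //.
  by rewrite -unitfE -unitmxE frac_vander_unit.
rewrite det_map_mx; apply: (@frac_neq0 _ (pair_ev idfun (fun _ => 0) (fun _ => 0) 1%:M)).
by rewrite -det_map_mx pair_ev_C det1 oner_neq0.
Qed.

Lemma frac_x_inj : injective frac_x.
Proof.
move=> i j /eqP; rewrite tofrac_eq => /eqP.
move/(congr1 (pair_ev idfun (fun l => (l == i)%:R) (fun _ => 0) (0 : 'M[rat]_n))).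
by rewrite !pair_ev_x eqxx; case: eqP => // _ /eqP; rewrite oner_eq0.
Qed.

Lemma frac_v_free t : injective t -> (\matrix_(a, j) frac_v (t j) a 0) \in unitmx.
Proof.
move=> t_inj; rewrite unitmxE unitfE.
have -> : \matrix_(a, j) frac_v (t j) a 0 = map_mx frac (\matrix_(a, j) var_v (t j) a 0).
  by apply/matrixP=> a j; rewrite !mxE.
(* The selected vectors are specialized to the unit vectors, so that their matrix becomes the
   identity. *)
pose v i : 'cV[rat]_n := \col_a (t a == i)%:R.
rewrite det_map_mx; apply: (@frac_neq0 _ (pair_ev idfun (fun _ => 0) v 0)).
rewrite -det_map_mx.
rewrite (_ : map_mx _ _ = 1%:M) ?det1 ?oner_neq0 //.
apply/matrixP=> a j; rewrite !mxE -(inj_eq t_inj).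
by have /colP/(_ a) := pair_ev_v idfun (fun _ => 0) v 0 (t j); rewrite !mxE.
Qed.

Lemma frac_v_neq0 i : frac_v i != 0.
Proof.
apply/eqP=> /colP/(_ (Ordinal n_gt0)) /eqP; rewrite !mxE tofrac_eq0 => /eqP.
move/(congr1 (pair_ev idfun (fun _ => 0) (fun _ => const_mx 1) (0 : 'M[rat]_n))).
have /colP/(_ (Ordinal n_gt0)) :=
  pair_ev_v idfun (fun _ => 0) (fun _ : 'I_d => const_mx 1) (0 : 'M[rat]_n) i.
by rewrite !mxE => ->; rewrite rmorph0 => /eqP; rewrite oner_eq0.
Qed.

Lemma frac_A_eigen i : pencil frac_A (frac_x i) *m frac_v i = 0.
Proof. exact: interp_mx_eigen. Qed.

Definition permute_pairs (t : 'S_d) (s : pair_var k n) : pair_var k n :=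
  match s with
  | inl (inl i) => inl (inl (t i))
  | inl (inr ij) => inl (inr (t ij.1, ij.2))
  | inr ab => inr ab
  end.

Definition permute_var (t : 'S_d) : {rmorphism P -> P} :=
  mmap (@mpolyC #|pair_var k n| rat) (fun i => gen_var (permute_pairs t (enum_val i))).

Lemma permute_varE t s : permute_var t (gen_var s) = gen_var (permute_pairs t s).
Proof. by rewrite /= mmapX mmap1U enum_rankK. Qed.

Lemma permute_varK (t : 'S_d) : cancel (permute_var t) (permute_var t^-1%g).
Proof.
apply: (gen_eval_ext (f := permute_var t^-1%g \o permute_var t) (g := idfun)) => s.
rewrite [LHS]/= -/(permute_var t _) -/(permute_var t^-1%g _) !permute_varE.
by case: s => [[i|[i j]]|ab] //=; rewrite permK.
Qed.

Lemma permute_frac (t : 'S_d) : exists al : {rmorphism M -> M},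
  [/\ forall i, al (frac_x i) = frac_x (t i), forall i, map_mx al (frac_v i) = frac_v (t i),
     map_mx al frac_C = frac_C & forall r, map_mx al (frac_A r) = frac_A r].
Proof.
have inj_al : injective (frac \o permute_var t).
  move=> p q /= /eqP; rewrite tofrac_eq => /eqP.
  exact: (can_inj (permute_varK t)).
have inj_frac : injective frac by move=> p q /eqP; rewrite tofrac_eq => /eqP.
have [al alE] := rmorphism_of_fractions inj_frac inj_al (@fraction_ratio _).
have alx i : al (frac_x i) = frac_x (t i).
  by rewrite alE [LHS]/= -/(permute_var t _) permute_varE.
have alv i : map_mx al (frac_v i) = frac_v (t i).
  by apply/colP=> j; rewrite !mxE alE [LHS]/= -/(permute_var t _) permute_varE.
have alC : map_mx al frac_C = frac_C.
  by apply/matrixP=> a b; rewrite !mxE alE [LHS]/= -/(permute_var t _) permute_varE.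
have eq_x : (fun i => al (frac_x i)) = (fun i => frac_x (t i)) by apply: functional_extensionality.
have eq_v : (fun i => map_mx al (frac_v i)) = (fun i => frac_v (t i)).
  by apply: functional_extensionality.
exists al; split=> // r; rewrite /frac_A map_interp_mx alC eq_x eq_v.
exact: (interp_mx_perm frac_C t r frac_vander_unit).
Qed.
End GenericModel.

Section GenericMatrices.
Variables (k n : nat) (k_gt0 : (0 < k)%N) (n_gt0 : (0 < n)%N).
Variables (K : fieldType) (phi : {rmorphism rat -> K}) (A : 'I_k.+1 -> 'M[K]_n).
Hypotheses (hgeneric : generic_matrices phi A) (hK : generated_by_entries phi A).
Variables (Kbar : closedFieldType) (iota : {rmorphism K -> Kbar}).
Local Notation M := {fraction {mpoly rat[#|pair_var k n|]}}.

Definition var_A (r : 'I_k.+1) : 'M_n := \matrix_(i, j) gen_var ((r, i, j) : coef_var k n).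

Lemma gen_eval_var_A (S : comUnitRingType) (psi : {rmorphism rat -> S}) (B : 'I_k.+1 -> 'M[S]_n) r :
  map_mx (gen_eval psi (entries B : coef_var k n -> S)) (var_A r) = B r.
Proof. by apply/matrixP=> i j; rewrite !mxE gen_eval_var. Qed.

Lemma gen_eval_pencil_det (S : comUnitRingType) (psi : {rmorphism rat -> S}) (B : 'I_k.+1 -> 'M[S]_n) :
  map_poly (gen_eval psi (entries B : coef_var k n -> S)) (pencil_det var_A) = pencil_det B.
Proof.
rewrite map_pencil_det; congr pencil_det; apply: functional_extensionality => r.
exact: gen_eval_var_A.
Qed.

(** [evK] and [evM] evaluate the same polynomial ring in the coefficients, at [A] and at the
    interpolated pencil; K embeds in [M] once both are injective. *)
Definition evK : {rmorphism {mpoly rat[#|coef_var k n|]} -> K} :=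
  gen_eval phi (entries A : coef_var k n -> K).
Definition evM : {rmorphism {mpoly rat[#|coef_var k n|]} -> M} :=
  gen_eval (@frac_rat k n) (entries (@frac_A k n) : coef_var k n -> M).

Lemma evK_inj : injective evK.
Proof.
move=> p q /eqP; rewrite -subr_eq0 -rmorphB => /eqP/hgeneric/eqP.
by rewrite subr_eq0 => /eqP.
Qed.

Lemma generic_pchar0 : [pchar K] =i pred0.
Proof. by move=> p; rewrite (fmorph_pchar phi) Num.Theory.pchar_num. Qed.

(** The roots are plainly distinct in [M], and the resultant carries this over to K. The transfer
    has to go in this direction, because [evM_inj] relies on the eigenpairs of [A]. *)
Lemma separable_generic : separable_poly (pencil_det A).
Proof.
rewrite -(gen_eval_pencil_det phi A); have [sz top] := pencil_det_top var_A.
apply: (separable_specialize (f := evM) (m := (k * n)%N)) => //.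
- exact: frac_pchar0.
- exact: evK_inj.
- by rewrite muln_gt0 k_gt0.
- by rewrite top -det_map_mx gen_eval_var_A -unitfE -unitmxE frac_A_unit.
rewrite gen_eval_pencil_det.
rewrite (pencil_det_factor (frac_A_unit k n) (@frac_x_inj k n) (frac_v_neq0 n_gt0) (@frac_A_eigen k n)).
apply: separable_linear_factors; last exact: frac_x_inj.
by rewrite -unitfE -unitmxE frac_A_unit.
Qed.

Lemma generic_top : A ord_max \in unitmx.
Proof.
rewrite unitmxE unitfE -(gen_eval_var_A phi A) det_map_mx.
rewrite -(rmorph0 evK) (inj_eq evK_inj).
have := frac_A_unit k n; rewrite unitmxE unitfE -(gen_eval_var_A (@frac_rat k n) (@frac_A k n)) det_map_mx.
by apply: contraNneq => ->; rewrite rmorph0.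
Qed.

Lemma evM_frac p :
  evM p = tofrac (gen_eval (@mpolyC #|pair_var k n| rat)
    (entries (interp_mx (@var_x k n) (@var_v k n) (var_C k n)) : coef_var k n -> _) p).
Proof.
pose g := gen_eval (@mpolyC #|pair_var k n| rat)
    (entries (interp_mx (@var_x k n) (@var_v k n) (var_C k n)) : coef_var k n -> _).
apply: (gen_eval_ext (f := evM) (g := @tofrac _ \o g)) => t.
rewrite [RHS]/= -/(g _) /g /evM !gen_eval_var /entries.
have /matrixP/(_ t.1.2 t.2) := map_interp_mx (@tofrac _) (@var_x k n) (@var_v k n) (var_C k n) t.1.1.
by rewrite mxE => ->.
Qed.

(** A relation between the interpolated coefficients is a polynomial identity in the indeterminates,
    so it survives specialization to the eigenpairs of [A] over [Kbar]. There interpolation gives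
    back [A], whose entries satisfy no relation. *)
Lemma evM_inj : injective evM.
Proof.
move=> p q /eqP; rewrite -subr_eq0 -rmorphB evM_frac tofrac_eq0 => /eqP.
set p0 := p - q; move=> p0_0.
pose B r := map_mx iota (A r).
have unitB : B ord_max \in unitmx by rewrite map_unitmx generic_top.
have sepB : separable_poly (pencil_det B).
  by rewrite -map_pencil_det separable_map separable_generic.
have [x [v [x_inj nz_v Bv]]] := closed_eigenpairs unitB sepB.
have unitW := block_vander_unit unitB x_inj nz_v Bv.
(* The scaling undoes the squared determinant built into [interp_mx]. *)
pose C := (\det (block_vander k x v) ^+ 2)^-1 *: B ord_max.
pose psi : {rmorphism rat -> Kbar} := iota \o phi.
have evB : (pair_ev psi x v C) (gen_eval (@mpolyC #|pair_var k n| rat)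
    (entries (interp_mx (@var_x k n) (@var_v k n) (var_C k n)) : coef_var k n -> _) p0) = iota (evK p0).
  set g := gen_eval (@mpolyC _ _) _.
  apply: (gen_eval_ext (f := pair_ev psi x v C \o g) (g := iota \o evK)) => t.
  rewrite [LHS]/= -/(g _) [RHS]/= -/(evK _) /g /evK !gen_eval_var /entries.
  have /matrixP/(_ t.1.2 t.2) := pair_ev_interp psi x v C t.1.1.
  by rewrite (interp_mx_uniq _ unitW Bv) !mxE.
move: evB; rewrite p0_0 rmorph0 => /esym/eqP; rewrite fmorph_eq0.
by rewrite -(rmorph0 evK) (inj_eq evK_inj) subr_eq0 => /eqP.
Qed.

Lemma evK_fractions c : exists a b, c = evK a / evK b.
Proof.
suffices [a [b [_ Dc]]] : exists a b, evK b != 0 /\ c = evK a / evK b by exists a, b.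
apply: (adjoin_sub (E := fun c => exists a b, evK b != 0 /\ c = evK a / evK b) _ _ _ (hK c))
  => {c} [|_ [q ->]|_ [t ->]].
- split=> [|_ _ [a [b [nzb ->]]] [a' [b' [nzb' ->]]]|
             _ _ [a [b [nzb ->]]] [a' [b' [nzb' ->]]]].
  + by exists 1, 1; rewrite rmorph1 oner_neq0 divr1.
  + exists (a * b' - a' * b), (b * b'); rewrite rmorphM mulf_neq0 //; split=> //.
    by rewrite -mulNr addf_div // rmorphB !rmorphM mulNr.
  + have [a'0|nza'] := eqVneq (evK a') 0.
      by exists 0, 1; rewrite rmorph1 oner_neq0 rmorph0 a'0 mul0r invr0 mulr0 mul0r.
    exists (a * b'), (b * a'); rewrite !rmorphM mulf_neq0 //; split=> //.
    by rewrite invf_div mulf_div.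
- by exists q%:MP, 1; rewrite rmorph1 oner_neq0 divr1 /evK gen_eval_const.
by exists (gen_var t), 1; rewrite rmorph1 oner_neq0 divr1 /evK gen_eval_var.
Qed.

Lemma generic_embedding : exists j : {rmorphism K -> M},
  (forall r, map_mx j (A r) = @frac_A k n r) /\ symmetric_relations j (@frac_x k n).
Proof.
have [j jE] := rmorphism_of_fractions evK_inj evM_inj evK_fractions.
have jA r : map_mx j (A r) = @frac_A k n r.
  rewrite -(gen_eval_var_A phi A) -(gen_eval_var_A (@frac_rat k n) (@frac_A k n)) -map_mx_comp.
  by apply/matrixP=> a b; rewrite !mxE; apply: jE.
exists j; split=> // t h h0.
have [al [alx _ _ alA]] := permute_frac t.
(* Applying [al] to a relation permutes the roots; the coefficients stay put since [al] fixes the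
   entries that generate K. *)
suffices alj c : al (j c) = j c by rewrite -(mmap_rmorph h alj alx) h0 rmorph0.
apply: (adjoin_sub (E := fun c => al (j c) = j c) _ _ _ (hK c)) => [|_ [q ->]|_ [s ->]].
- split=> [|x y jx jy|x y jx jy]; first by rewrite !rmorph1.
    by rewrite !rmorphB jx jy.
  by rewrite !fmorph_div jx jy.
- have := fmorph_eq_rat (al \o (j \o phi)) q; rewrite /= => ->.
  by have := fmorph_eq_rat (j \o phi) q; rewrite /= => ->.
have /matrixP/(_ s.1.2 s.2) := alA s.1.1.
by rewrite -jA !mxE.
Qed.

End GenericMatrices.

(** * Quartic equations *)

Ltac subfield_closed :=
  repeat first [ assumption | exact: subfield_nat | exact: subfield1
    | apply: subfieldN | apply: subfieldB | apply: subfieldD | apply: subfieldM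
    | apply: subfieldX ].

Lemma subfield_divn (M : fieldType) (E : M -> Prop) a m : [pchar M] =i pred0 ->
  is_subfield E -> (0 < m)%N -> E (m%:R * a) -> E a.
Proof.
move=> ch0 sfE m_gt0 Ema; have nzm : m%:R != 0 :> M by move/pcharf0P: ch0 => ->; rewrite -lt0n.
by rewrite -(mulKf nzm a) mulrC; apply: subfield_div => //; apply: subfield_nat.
Qed.

Section Quartic.
Variables (M : closedFieldType) (F : M -> Prop).
Hypotheses (sfF : is_subfield F) (ch0 : [pchar M] =i pred0).
Variables (z1 z2 z3 z4 : M).
Let e1 := z1 + z2 + z3 + z4.
Let e2 := z1 * z2 + z1 * z3 + z1 * z4 + z2 * z3 + z2 * z4 + z3 * z4.
Let e3 := z1 * z2 * z3 + z1 * z2 * z4 + z1 * z3 * z4 + z2 * z3 * z4.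
Let e4 := z1 * z2 * z3 * z4.
Hypotheses (F1 : F e1) (F2 : F e2) (F3 : F e3) (F4 : F e4).

Lemma radical_adjoin_root (E : M -> Prop) (a : M) m :
    radical_extension F E -> (0 < m)%N -> E (a ^+ m) ->
  exists E', [/\ radical_extension F E', is_subfield E', forall y, E y -> E' y & E' a].
Proof.
move=> radE m_gt0 Eam; exists (adjoin E (fun y => y = a)); split.
- exact: radical_step radE m_gt0 Eam.
- exact: adjoin_subfield.
- by move=> y Ey; apply: adjoin_base.
exact: adjoin_gen.
Qed.

(* Ferrari and Cardano by Lagrange resolvents. *)
Lemma quartic_radical : exists R, [/\ radical_extension F R, R z1, R z2, R z3 & R z4].
Proof.
(* A primitive cube root of unity; [- 1 - om] below is its square. *)
have [om om0] : exists om : M, om ^+ 2 + om + 1 = 0.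
  have [|om /rootP] := closed_rootP (('X^2 + 'X + 1 : {poly M})) _.
    rewrite size_polyDl ?size_polyDl ?size_polyXn ?size_polyX ?size_poly1 //.
  by rewrite !hornerE; exists om.
(* The squares [t1], [t2], [t3] are the roots of a resolvent cubic, with elementary symmetric
   functions [E1], [E2], [E3] in [F]; [u] and [w] are the Lagrange resolvents of this cubic. *)
pose s1 := z1 + z2 - z3 - z4; pose s2 := z1 - z2 + z3 - z4; pose s3 := z1 - z2 - z3 + z4.
pose t1 := s1 ^+ 2; pose t2 := s2 ^+ 2; pose t3 := s3 ^+ 2.
pose E1 := t1 + t2 + t3; pose E2 := t1 * t2 + t1 * t3 + t2 * t3; pose E3 := t1 * t2 * t3.
pose u := t1 + om * t2 + (- 1 - om) * t3; pose w := t1 + (- 1 - om) * t2 + om * t3.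
have FE1 : F E1.
  have -> : E1 = 3%:R * e1 ^+ 2 - 8%:R * e2.
    by rewrite /E1 /t1 /t2 /t3 /s1 /s2 /s3 /e1 /e2; ring.
  by subfield_closed.
have FE2 : F E2.
  have -> : E2 = 3%:R * e1 ^+ 4 - 16%:R * e1 ^+ 2 * e2 + 16%:R * e1 * e3
      + 16%:R * e2 ^+ 2 - 64%:R * e4.
    by rewrite /E2 /t1 /t2 /t3 /s1 /s2 /s3 /e1 /e2 /e3 /e4; ring.
  by subfield_closed.
have FE3 : F E3.
  have -> : E3 = (e1 ^+ 3 - 4%:R * e1 * e2 + 8%:R * e3) ^+ 2.
    by rewrite /E3 /t1 /t2 /t3 /s1 /s2 /s3 /e1 /e2 /e3; ring.
  by subfield_closed.
have uw : u * w = E1 ^+ 2 - 3%:R * E2.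
  suffices -> : u * w = E1 ^+ 2 - 3%:R * E2 - (t2 - t3) ^+ 2 * (om ^+ 2 + om + 1).
    by rewrite om0 mulr0 subr0.
  by rewrite /u /w /E1 /E2; ring.
have uw3 : u ^+ 3 + w ^+ 3 = 2%:R * E1 ^+ 3 - 9%:R * E1 * E2 + 27%:R * E3.
  suffices -> : u ^+ 3 + w ^+ 3 = 2%:R * E1 ^+ 3 - 9%:R * E1 * E2 + 27%:R * E3
      + 3%:R * (t2 - t3) ^+ 2 * (t1 - t3 + (t1 - t2)) * (om ^+ 2 + om + 1).
    by rewrite om0 mulr0 addr0.
  by rewrite /u /w /E1 /E2 /E3; ring.
have Fuw : F (u * w).
  by rewrite uw; subfield_closed.
have Fuw3 : F (u ^+ 3 + w ^+ 3).
  by rewrite uw3; subfield_closed.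
have [|G1 [rad1 sf1 sF1 Gom]] := radical_adjoin_root (E := F) (a := om) (m := 3) (radical_base _) isT.
  have -> : om ^+ 3 = 1 + (om - 1) * (om ^+ 2 + om + 1) by ring.
  by rewrite om0 mulr0 addr0; apply: subfield1.
(* [u ^+ 3] and [w ^+ 3] are the roots of a quadratic over [F]; a square root of its discriminant is
   adjoined. *)
have [|G2 [rad2 sf2 sF2 Gdel]] := radical_adjoin_root (a := u ^+ 3 - w ^+ 3) (m := 2) rad1 isT.
  apply: sF1; have -> : (u ^+ 3 - w ^+ 3) ^+ 2 = (u ^+ 3 + w ^+ 3) ^+ 2 - 4%:R * (u * w) ^+ 3 by ring.
  by subfield_closed.
have G2F y : F y -> G2 y by move=> Fy; apply/sF2/sF1.
have [|G3 [rad3 sf3 sF3 Gu]] := radical_adjoin_root (a := u) (m := 3) rad2 isT.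
  apply: (subfield_divn ch0 (m := 2)) => //.
  have -> : 2%:R * u ^+ 3 = (u ^+ 3 + w ^+ 3) + (u ^+ 3 - w ^+ 3) by ring.
  by apply: subfieldD => //; apply: G2F.
(* [w] is adjoined through its own cube, since dividing [u * w] by [u] fails when [u = 0]. Likewise
   [s3] below gets its own square root. *)
have [|G4 [rad4 sf4 sF4 Gw]] := radical_adjoin_root (a := w) (m := 3) rad3 isT.
  apply: sF3; apply: (subfield_divn ch0 (m := 2)) => //.
  have -> : 2%:R * w ^+ 3 = (u ^+ 3 + w ^+ 3) - (u ^+ 3 - w ^+ 3) by ring.
  by apply: subfieldB => //; apply: G2F.
have G4E1 : G4 E1 by apply/sF4/sF3/G2F.
have {}Gu : G4 u by apply: sF4.
have {}Gom : G4 om by apply/sF4/sF3/sF2.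
have G4t1 : G4 t1.
  apply: (subfield_divn ch0 (m := 3)) => //.
  have -> : 3%:R * t1 = E1 + u + w by rewrite /E1 /u /w; ring.
  by subfield_closed.
have G4t2 : G4 t2.
  apply: (subfield_divn ch0 (m := 3)) => //.
  have -> : 3%:R * t2 = E1 + (- 1 - om) * u + om * w
      + (om ^+ 2 + om + 1) * (2%:R * t2 - t3 - t3 + 0).
    by rewrite /E1 /u /w; ring.
  rewrite om0 mul0r addr0.
  by subfield_closed.
have G4t3 : G4 t3.
  have -> : t3 = E1 - t1 - t2 by rewrite /E1; ring.
  by subfield_closed.
have [G5 [rad5 sf5 sF5 Gs1]] := radical_adjoin_root (a := s1) (m := 2) rad4 isT G4t1.
have [|G6 [rad6 sf6 sF6 Gs2]] := radical_adjoin_root (a := s2) (m := 2) rad5 isT.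
  exact: sF5.
have [|G7 [rad7 sf7 sF7 Gs3]] := radical_adjoin_root (a := s3) (m := 2) rad6 isT.
  by apply/sF6/sF5.
have {}Gs1 : G7 s1 by apply/sF7/sF6.
have {}Gs2 : G7 s2 by apply/sF7.
have Ge1 : G7 e1 by apply/sF7/sF6/sF5/sF4/sF3/G2F.
exists G7; split=> //; apply: (subfield_divn ch0 (m := 4)) => //.
- have -> : 4%:R * z1 = e1 + s1 + s2 + s3 by rewrite /e1 /s1 /s2 /s3; ring.
  by subfield_closed.
- have -> : 4%:R * z2 = e1 + s1 - s2 - s3 by rewrite /e1 /s1 /s2 /s3; ring.
  by subfield_closed.
- have -> : 4%:R * z3 = e1 - s1 + s2 - s3 by rewrite /e1 /s1 /s2 /s3; ring.
  by subfield_closed.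
have -> : 4%:R * z4 = e1 - s1 - s2 + s3 by rewrite /e1 /s1 /s2 /s3; ring.
by subfield_closed.
Qed.
End Quartic.

(** * Proof of the theorem *)

Lemma map_eigen_sol (F F' : fieldType) (e : {rmorphism F -> F'}) k n
    (x : 'I_(k * n) -> F) (v : 'I_(k * n) -> 'cV[F]_n) t :
  map_mx e (eigen_sol x v t) =
  eigen_sol (fun i => e (x i)) (fun i => map_mx e (v i)) t.
Proof.
rewrite /eigen_sol !map_mxM map_invmx map_diag_mx.
have -> : map_mx e (eigen_mx v t) = eigen_mx (fun i => map_mx e (v i)) t.
  by apply/matrixP=> a j; rewrite !mxE.
by congr (_ *m diag_mx _ *m _); apply/rowP=> j; rewrite !mxE.
Qed.

Section EigenvaluesOfSolutions.
Variables (F : fieldType) (k n : nat) (A : 'I_k.+1 -> 'M[F]_n).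
Variables (x : 'I_(k * n) -> F) (v : 'I_(k * n) -> 'cV[F]_n).
Hypotheses (Av : forall i, pencil A (x i) *m v i = 0).
Hypothesis free_v : forall t : 'I_n -> 'I_(k * n), injective t ->
  (\matrix_(a, j) v (t j) a 0) \in unitmx.
Hypotheses (ch0 : [pchar F] =i pred0) (k_gt1 : (1 < k)%N) (n_gt1 : (1 < n)%N).
Variables (E : F -> Prop) (sfE : is_subfield E).
Hypothesis solE : forall X, mx_solution A X -> mx_over E X.

(** The sum is the trace of the solution with these eigenvalues. *)
Lemma subset_sum_in (s : seq 'I_(k * n)) : size s = n -> uniq s -> E (\sum_(i <- s) x i).
Proof.
move=> szs uniq_s; have [i0 _] : exists i : 'I_(k * n), true.
  by move: szs; case: (s) => [|i ?] szs; [move: n_gt1; rewrite -szs | exists i].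
pose t (j : 'I_n) := nth i0 s j.
have t_inj : injective t.
  by move=> i j /eqP; rewrite nth_uniq ?szs // => /eqP/val_inj.
have := solE (eigen_sol_solution Av free_v t_inj).
rewrite (big_nth i0) szs big_mkord -(trace_eigen_sol x free_v t_inj) => solE_t.
by apply: subfield_sum.
Qed.

(** Two sets of n roots that differ only by exchanging [i] and [m] have sums whose difference is
    [x i - x m]. *)
Lemma eigenvalue_sub_in i m : E (x i - x m).
Proof.
have [->|ne_im] := eqVneq i m; first by rewrite subrr; apply: subfield0.
pose rest := [seq l <- enum 'I_(k * n) | (l != i) && (l != m)].
pose s := take n.-1 rest.
have sz_rest : size rest = (k * n - 2)%N.
  have <- : #|~: [set i; m]| = size rest.
    have uniq_rest : uniq rest by rewrite filter_uniq // enum_uniq.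
    rewrite -(card_uniqP uniq_rest); apply: eq_card => l.
    by rewrite mem_filter mem_enum !inE negb_or andbT.
  by rewrite cardsCs setCK card_ord cards2 ne_im.
(* Enough other roots are left, because kn - 2 >= 2n - 2 >= n - 1. *)
have szs : size s = n.-1.
  rewrite size_takel // sz_rest; apply: leq_trans (leq_sub2r 2 (leq_mul k_gt1 (leqnn n))).
  by lia.
have sz1 : (size s).+1 = n by rewrite szs prednK // ltnW.
have uniq_s : uniq s by rewrite take_uniq // filter_uniq // enum_uniq.
have notin l : l \in s -> (l != i) && (l != m).
  by move/mem_take; rewrite mem_filter => /andP[].
have Ei : E (\sum_(l <- i :: s) x l).
  apply: subset_sum_in => //=; rewrite uniq_s andbT.
  by apply/negP=> /notin; rewrite eqxx.
have Em : E (\sum_(l <- m :: s) x l).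
  apply: subset_sum_in => //=; rewrite uniq_s andbT.
  by apply/negP=> /notin; rewrite eqxx andbF.
have -> : x i - x m = \sum_(l <- i :: s) x l - \sum_(l <- m :: s) x l.
  by rewrite !big_cons opprD addrACA subrr addr0.
exact: subfieldB.
Qed.

(** n times a root is a sum of n roots plus differences of roots, and n is invertible in
    characteristic 0. *)
Lemma eigenvalue_in i : E (x i).
Proof.
pose s := take n (enum 'I_(k * n)).
have szs : size s = n by rewrite size_takel // size_enum_ord leq_pmull // ltnW.
have uniq_s : uniq s by rewrite take_uniq // enum_uniq.
apply: (subfield_divn ch0 (m := n)) => //; first exact: ltnW.
have -> : n%:R * x i = \sum_(l <- s) x l + \sum_(l <- s) (x i - x l).
  rewrite sumrB addrCA subrr addr0 big_const_seq count_predT szs.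
  by rewrite iter_addr addr0 mulr_natl.
apply: subfieldD => //; first exact: subset_sum_in.
by elim/big_rec: _ => [|l y _ Ey]; [apply: subfield0 | apply: subfieldD => //; apply: eigenvalue_sub_in].
Qed.
End EigenvaluesOfSolutions.

Lemma quartic_coefs (F : fieldType) (E : F -> Prop) (z1 z2 z3 z4 : F) : is_subfield E ->
    (forall l, E (('X - z1%:P) * ('X - z2%:P) * ('X - z3%:P) * ('X - z4%:P))`_l) ->
  [/\ E (z1 + z2 + z3 + z4),
      E (z1 * z2 + z1 * z3 + z1 * z4 + z2 * z3 + z2 * z4 + z3 * z4),
      E (z1 * z2 * z3 + z1 * z2 * z4 + z1 * z3 * z4 + z2 * z3 * z4)
    & E (z1 * z2 * z3 * z4)].
Proof.
move=> sfE Ecoef; set p := _ * _ * _ * _ in Ecoef.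
have Dp : p = 'X^4 - (z1 + z2 + z3 + z4)%:P * 'X^3
   + (z1 * z2 + z1 * z3 + z1 * z4 + z2 * z3 + z2 * z4 + z3 * z4)%:P * 'X^2
   - (z1 * z2 * z3 + z1 * z2 * z4 + z1 * z3 * z4 + z2 * z3 * z4)%:P * 'X
   + (z1 * z2 * z3 * z4)%:P.
  by rewrite /p; ring.
split.
- by have := Ecoef 3; rewrite Dp !coefE /= => /(subfieldN sfE); rewrite ?(mulr0, mulr1, addr0, subr0, sub0r, opprK, add0r).
- by have := Ecoef 2; rewrite Dp !coefE /= ?(mulr0, mulr1, addr0, subr0, sub0r, opprK, add0r, oppr0).
- by have := Ecoef 1; rewrite Dp !coefE /= => /(subfieldN sfE); rewrite ?(mulr0, mulr1, addr0, subr0, sub0r, opprK, add0r, oppr0).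
by have := Ecoef 0; rewrite Dp !coefE /= ?(mulr0, mulr1, addr0, subr0, sub0r, opprK, add0r, oppr0).
Qed.

Lemma map_in_alg_mx (K : fieldType) (L : fieldExtType K) (M : fieldType)
    (e : {rmorphism L -> M}) (j : {rmorphism K -> M}) n (C : 'M[K]_n) :
  (forall c, e c%:A = j c) -> map_mx e (map_mx (in_alg L) C) = map_mx j C.
Proof. by move=> ej; apply/matrixP=> a b; rewrite !mxE; apply: ej. Qed.

Section Eigendata.
Variables (k n : nat) (K : fieldType) (A : 'I_k.+1 -> 'M[K]_n).

Definition eigendata (M : fieldType) (j : {rmorphism K -> M}) (z : 'I_(k * n) -> M)
    (v : 'I_(k * n) -> 'cV[M]_n) :=
  [/\ injective z, forall i, v i != 0,
      forall i, pencil (fun r => map_mx j (A r)) (z i) *m v i = 0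
    & forall t : 'I_n -> 'I_(k * n), injective t -> (\matrix_(a, j) v (t j) a 0) \in unitmx].

Lemma eigendata_map (M M' : fieldType) (j : {rmorphism K -> M}) (j' : {rmorphism K -> M'})
    (e : {rmorphism M -> M'}) z v : (forall c, e (j c) = j' c) ->
  eigendata j z v -> eigendata j' (fun i => e (z i)) (fun i => map_mx e (v i)).
Proof.
move=> ej [z_inj nz_v Av free_v]; split.
- by move=> i l /fmorph_inj/z_inj.
- by move=> i; rewrite map_mx_eq0.
- move=> i; rewrite -(map_mx0 e) -(Av i) map_mxM map_pencil; congr (pencil _ _ *m _).
  by apply: functional_extensionality => r; apply/matrixP=> a b; rewrite !mxE ej.
move=> t t_inj; rewrite (_ : \matrix_(_, _) _ = map_mx e (\matrix_(a, j) v (t j) a 0)).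
  by rewrite map_unitmx free_v.
by apply/matrixP=> a l; rewrite !mxE.
Qed.

Variables (unitA : A ord_max \in unitmx) (ch0 : [pchar K] =i pred0).
Variables (M : fieldType) (j : {rmorphism K -> M}) (x : 'I_(k * n) -> M) (w : 'I_(k * n) -> 'cV[M]_n).
Hypothesis eigM : eigendata j x w.

(** The roots generate a finite extension [L], but the entries of the [w i] need not lie in it.
    Kernel vectors are chosen anew over [L]; in [M] they are nonzero multiples of the [w i], so any
    n of them remain independent. *)
Lemma eigendata_descent : exists (L : fieldExtType K) (e0 : {rmorphism L -> M}) z v,
  [/\ eigendata (in_alg L) z v, forall c, e0 c%:A = j c, forall i, e0 (z i) = x i
    & <<1 & codom z>>%VS = fullv].
Proof.
have [x_inj nz_w AMw free_w] := eigM.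
pose AM r := map_mx j (A r).
have unitAM : AM ord_max \in unitmx by rewrite map_unitmx.
have alg_x y : y \in codom x -> algebraicOver j y.
  case/codomP=> i ->; exists (pencil_det A).
    rewrite -(map_poly_eq0 j) map_pencil_det (pencil_det_factor unitAM x_inj nz_w AMw).
    rewrite scaler_eq0 negb_or -unitfE -unitmxE unitAM; apply/prodf_neq0 => l _.
    by rewrite polyXsubC_eq0.
  rewrite /root map_pencil_det horner_pencil_det -det_tr; apply/det0P.
  by exists (w i)^T; rewrite ?trmx_eq0 ?nz_w // -trmx_mul AMw trmx0.
have [L [e0 [s [e0C e0s genL]]]] := fieldExt_generated ch0 alg_x.
have lift_x i : {y | e0 y == x i}.
  apply: sigW; have : x i \in map e0 s by rewrite e0s codom_f.
  by case/mapP=> y _ ->; exists y.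
pose z i := sval (lift_x i).
have e0z i : e0 (z i) = x i := eqP (svalP (lift_x i)).
pose AL r := map_mx (in_alg L) (A r).
have e0AL r : map_mx e0 (AL r) = AM r by apply: map_in_alg_mx.
have e0pencil i : map_mx e0 (pencil AL (z i)) = pencil AM (x i).
  rewrite map_pencil e0z; congr (pencil _ _); exact: functional_extensionality.
have ker_z i : \det (pencil AL (z i)) = 0.
  apply: (fmorph_inj e0); rewrite rmorph0 -det_map_mx e0pencil -det_tr; apply/eqP/det0P.
  by exists (w i)^T; rewrite ?trmx_eq0 ?nz_w // -trmx_mul AMw trmx0.
pose v i := sval (pencil_ker (ker_z i)).
have nz_v i : v i != 0 by have /andP[] := svalP (pencil_ker (ker_z i)).
have Av i : pencil AL (z i) *m v i = 0 by have /andP[_ /eqP] := svalP (pencil_ker (ker_z i)).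
have z_inj : injective z by move=> i l eq_il; apply: x_inj; rewrite -!e0z eq_il.
have line i : exists b, map_mx e0 (v i) = b *: w i.
  apply: (eigen_line unitAM x_inj nz_w AMw).
  by rewrite -e0pencil -map_mxM Av map_mx0.
exists L, e0, z, v; split=> //.
- split=> // t t_inj; rewrite unitmxE unitfE -(fmorph_eq0 e0) -det_map_mx.
  have /fin_all_exists[b Db] j0 : exists b, map_mx e0 (v (t j0)) = b *: w (t j0) by [].
  have -> : map_mx e0 (\matrix_(a, j) v (t j) a 0)
      = (\matrix_(a, j) w (t j) a 0) *m diag_mx (\row_j b j).
    rewrite mul_mx_diag; apply/matrixP=> a j0; rewrite !mxE.
    by have /colP/(_ a) := Db j0; rewrite !mxE mulrC.
  rewrite det_mulmx mulf_neq0 //; first by rewrite -unitfE -unitmxE free_w.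
  rewrite det_diag; apply/prodf_neq0 => j0 _; rewrite mxE.
  apply: contraNneq (nz_v (t j0)) => b0; rewrite -(map_mx_eq0 e0).
  by rewrite Db b0 scale0r.
rewrite (_ : codom z = s) //; apply: (inj_map (fmorph_inj e0)).
by rewrite e0s -map_comp; apply: eq_map => i; apply: e0z.
Qed.
End Eigendata.

Lemma generic_eigendata k n (k_gt0 : (0 < k)%N) (n_gt0 : (0 < n)%N)
    (K : fieldType) (phi : {rmorphism rat -> K}) (A : 'I_k.+1 -> 'M[K]_n)
    (hgeneric : generic_matrices phi A) (hK : generated_by_entries phi A)
    (Kbar : closedFieldType) (iota : {rmorphism K -> Kbar}) :
  exists (L : fieldExtType K) (e : {rmorphism L -> Kbar}) z v,
  [/\ eigendata A (in_alg L) z v, forall c, e c%:A = iota c, symmetric_relations (in_alg L) z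
    & <<1 & codom z>>%VS = fullv].
Proof.
have ch0 := generic_pchar0 phi; have unitA := generic_top hgeneric.
have [j [jA symj]] := generic_embedding k_gt0 n_gt0 hgeneric hK iota.
have DA : (fun r => map_mx j (A r)) = @frac_A k n by apply: functional_extensionality.
have eigM : eigendata A j (@frac_x k n) (@frac_v k n).
  split; [exact: frac_x_inj | exact: frac_v_neq0 | | exact: frac_v_free].
  by rewrite DA; apply: frac_A_eigen.
have [L [e0 [z [v [eigL e0C e0z genL]]]]] := eigendata_descent unitA ch0 eigM.
have [e eC] := fieldExt_embed L iota ch0.
exists L, e, z, v; split; [exact: eigL | exact: eC | | exact: genL].
exact: (iffRL (@symmetric_relations_rmorph _ _ _ (in_alg L) e0 j _ _ _ e0C e0z)).
Qed.

(** The roots generate [L], so [L] is itself a splitting field of [p], and the symmetric relations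
    give its Galois group. *)
Lemma generic_galois_group (K : fieldType) (L : fieldExtType K) d (z : 'I_d -> L) (p : {poly K}) c :
    [pchar K] =i pred0 -> injective z -> c != 0 ->
    map_poly (in_alg L) p = c%:A *: \prod_i ('X - (z i)%:P) ->
    symmetric_relations (in_alg L) z -> <<1 & codom z>>%VS = fullv ->
  has_galois_group_Sym p d.
Proof.
move=> ch0 z_inj nz_c Dp symz genL.
have nz_cA : c%:A != 0 :> L by rewrite scaler_eq0 oner_eq0 orbF.
have splitL : splittingFieldFor 1%VS (map_poly (in_alg L) p) {:L}%VS.
  by exists (codom z) => //; rewrite Dp big_image eqp_scale.
have axL : SplittingField.axiom L by exists (map_poly (in_alg L) p); rewrite ?alg_polyOver.
pose N : splittingFieldType K := HB.pack L (FieldExt_isSplittingField.Build K L axL).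
exists N; first exact: splitL.
exact: (@gal_isog_Sym K ch0 N d z p c z_inj nz_c Dp symz genL).
Qed.

Lemma quartic_roots_radical (M : closedFieldType) (F : M -> Prop) d (x : 'I_d -> M) :
    is_subfield F -> [pchar M] =i pred0 -> d = 4%N ->
    (forall l, F (\prod_i ('X - (x i)%:P))`_l) ->
  exists2 R, radical_extension F R & forall i, R (x i).
Proof.
move=> sfF ch0 d4; subst d => coefF.
pose o l := x (inord l).
have xE (i : 'I_4) : x i = o i by rewrite /o inord_val.
have /(quartic_coefs sfF)[F1 F2 F3 F4] : forall l,
    F (('X - (o 0%N)%:P) * ('X - (o 1%N)%:P) * ('X - (o 2%N)%:P) * ('X - (o 3%N)%:P))`_l.
  move=> l; have := coefF l; under eq_bigr do rewrite xE.
  by rewrite !big_ord_recr big_ord0 /= mul1r.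
have [R [radR R0 R1 R2 R3]] := quartic_radical sfF ch0 F1 F2 F3 F4.
exists R => // i; rewrite xE.
by case: i => -[|[|[|[|]]]].
Qed.

Theorem theorem1 (k n : nat) (hk : (2 <= k)%N) (hn : (2 <= n)%N)
  (K : fieldType) (phi : {rmorphism rat -> K}) (A : 'I_k.+1 -> 'M[K]_n)
  (hgeneric : generic_matrices phi A) (hK : generated_by_entries phi A)
  (Kbar : closedFieldType) (iota : {rmorphism K -> Kbar})
  (hKbar : is_algebraic_closure iota) :
  let B : 'I_k.+1 -> 'M[Kbar]_n := fun r => map_mx iota (A r) in
  [/\ (exists2 s : seq 'M[Kbar]_n,
         finite_solutions B s & size s = 'C(k * n, n)),
      (forall X : 'M[Kbar]_n, mx_solution B X -> simple_solution B X),
      (exists (p : {poly K}) (lambda : 'I_(k * n) -> Kbar),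
         [/\ size p = (k * n).+1,
             map_poly iota p =
               iota (lead_coef p) *: \prod_i ('X - (lambda i)%:P),
             has_galois_group_Sym p (k * n),
             (forall X : 'M[Kbar]_n, mx_solution B X ->
                mx_over (adjoin (img iota) (img lambda)) X)
           & (forall L : Kbar -> Prop, is_subfield L ->
                (forall x : K, L (iota x)) ->
                (forall X : 'M[Kbar]_n, mx_solution B X -> mx_over L X) ->
                forall x : Kbar,
                  adjoin (img iota) (img lambda) x -> L x)])
    & (solvable_equation (img iota) B <-> (n = 2%N /\ k = 2%N))].
Proof.
move=> B; have [k_gt0 n_gt0] : (0 < k)%N /\ (0 < n)%N by split; apply: ltnW.
have ch0 := generic_pchar0 phi; have unitA := generic_top hgeneric.
have ch0bar : [pchar Kbar] =i pred0 by move=> q; rewrite (fmorph_pchar iota) ch0.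
have [L [e [z [v [eigL eC symz genL]]]]] :=
  generic_eigendata k_gt0 n_gt0 hgeneric hK iota.
have [z_inj nz_v Av free_v] := eigL.
pose x i := e (z i); pose w i := map_mx e (v i).
have [x_inj nz_w Bw free_w] : eigendata A iota x w by apply: eigendata_map eigL.
have unitB : B ord_max \in unitmx by rewrite map_unitmx.
have unitAL : map_mx (in_alg L) (A ord_max) \in unitmx by rewrite map_unitmx.
pose p := pencil_det A.
have [szp_le topp] := pencil_det_top A.
have nz_top : \det (A ord_max) != 0 by rewrite -unitfE -unitmxE.
have szp : size p = (k * n).+1.
  apply/eqP; rewrite eqn_leq szp_le ltnNge; apply: contraNN nz_top.
  by rewrite -topp => /leq_sizeP/(_ _ (leqnn _))->.
have leadp : lead_coef p = \det (A ord_max) by rewrite /lead_coef szp.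
have Dp : map_poly iota p = iota (lead_coef p) *: \prod_i ('X - (x i)%:P).
  by rewrite map_pencil_det (pencil_det_factor unitB x_inj nz_w Bw) leadp det_map_mx.
have DpL : map_poly (in_alg L) p = (lead_coef p)%:A *: \prod_i ('X - (z i)%:P).
  by rewrite map_pencil_det (pencil_det_factor unitAL z_inj nz_v Av) leadp det_map_mx.
have nz_lead : lead_coef p != 0 by rewrite leadp.
have symx : symmetric_relations iota x.
  exact: (iffLR (@symmetric_relations_rmorph _ _ _ (in_alg L) e iota _ _ _ eC (fun _ => erefl))).
have over_adj X : mx_solution B X -> mx_over (adjoin (img iota) (img x)) X.
  move=> /(solution_eigen_sol unitB x_inj nz_w Bw free_w)[t t_inj ->] a b.
  rewrite -(map_eigen_sol e z v) mxE.
  apply: (seq_adjoin_sub (s := codom z)); last by rewrite genL memvf.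
  - exact: adjoin_subfield.
  - by move=> c; rewrite eC; apply: adjoin_base; exists c.
  by move=> _ /codomP[i ->]; apply: adjoin_gen; exists i.
have minimal (E : Kbar -> Prop) : is_subfield E -> (forall X, mx_solution B X -> mx_over E X) ->
    forall i, E (x i).
  by move=> sfE solE i; apply: (eigenvalue_in Bw free_w).
have [s sols szs] := count_solutions k_gt0 unitB x_inj nz_w Bw free_w n_gt0.
split.
- by exists s.
- move=> X /(solution_eigen_sol unitB x_inj nz_w Bw free_w)[t t_inj ->].
  exact: eigen_sol_simple.
- exists p, x; split=> //.
    exact: generic_galois_group ch0 z_inj nz_lead DpL symz genL.
  move=> E sfE KE solE; apply: adjoin_sub => // [_ [c ->] //|_ [i ->]].
  exact: minimal.
split=> [[_ radX]|[n2 k2]].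
  pose Y := [seq (X : 'M[Kbar]_n) ab.1 ab.2 | X <- s, ab <- enum [set: 'I_n * 'I_n]].
  have le4 : (k * n <= 4)%N.
    apply: (symmetric_roots_radical ch0 hKbar (Y := Y) x_inj nz_lead Dp symx).
      move=> _ /allpairsP[[X ab] /= [sX _ ->]].
      have [R radR RX] := radX X (iffRL (sols.2 X) sX).
      by exists R => //; apply: RX.
    move=> E sfE KE YE; apply: minimal => // X /(sols.2 X) sX a b; apply: YE.
    by apply/allpairsP; exists (X, (a, b)); split; rewrite ?mem_enum ?inE.
  (* For k and n at least 2, kn <= 4 leaves only k = n = 2. *)
  nia.
split; first by exists s => //; rewrite -size_eq0 szs -lt0n bin_gt0 leq_pmull.
suffices [R radR Rx] : exists2 R, radical_extension (img iota) R & forall i, R (x i).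
  have [sfR KR] := radical_extension_subfield (img_subfield iota) radR.
  move=> X /over_adj adjX; exists R => // a b.
  by apply: adjoin_sub (adjX a b) => // _ [i ->].
(* After division by the leading coefficient, the symmetric functions of the four roots lie in K, as
   the quartic formulas require. *)
have Dprod : \prod_i ('X - (x i)%:P) = map_poly iota ((lead_coef p)^-1 *: p).
  by rewrite map_polyZ Dp fmorphV scalerK // fmorph_eq0.
have coefK l : img iota (\prod_i ('X - (x i)%:P))`_l by rewrite Dprod coef_map; eexists.
by apply: quartic_roots_radical coefK; [exact: img_subfield | exact: ch0bar | rewrite n2 k2].
Qed.
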